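(* Let $F$ denote either $C$ or $D$: $F(\mathbb R)$ is either $C(\mathbb R)$ endowed with the metric $d$, or $D(\mathbb R)$ endowed with the metric $d_S$. Let $U$ be an interval with $u$ an interior point and let $\{X(t,v):(t,v)\in U\times U\}$ be a real-valued random field. Suppose that for some $h>0$ the process $\{X(t,u):t\in U\}$ of $F(U)$ is strongly $h$-localisable at $u$, with local form $X_u'(\cdot,u)$ a random function of $F(\mathbb R)$. Suppose that for all $c>0$ $$\mathsf P\left(\sup_{0<|v-u|<\epsilon}\frac{|X(v,v)-X(v,u)|}{|v-u|^{h}}>c\right)\to0\quad\text{as }\epsilon\to0.$$ If the process $Y=\{X(t,t):t\in U\}$ is in $F(U)$, then $Y$ is strongly $h$-localisable at $u$ with $Y_u'(\cdot)=X_u'(\cdot,u)$. In particular, this conclusion holds if, in place of the displayed condition, for some $\eta>h$ we have $$\sup_{v\in U,\,v\ne u}\frac{|X(v,v)-X(v,u)|}{|v-u|^{\eta}}<\infty\quad\text{almost surely.}$$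
   Context: $C(T)$ is the space of continuous functions on $T$ and $D(T)$ the space of càdlàg functions on $T$. On $C(\mathbb R)$, $d(x,y)=\sum_{\tau=1}^\infty2^{-\tau}\min\{1,\sup_{|t|\le\tau}|x(t)-y(t)|\}$. On $D([a,b])$ the Skorohod metric $d_S^{[a,b]}(x,y)$ is the infimum of $\delta>0$ for which there is a strictly increasing continuous bijection $\phi:[a,b]\to[a,b]$ with $\sup_{a\le t\le b}|\phi(t)-t|\le\delta$ and $\sup_{a\le t\le b}|x(t)-y(\phi(t))|\le\delta$; on $D(\mathbb R)$, $d_S(x,y)=\sum_{\tau=1}^\infty2^{-\tau}\min\{1,d_S^{[-\tau,\tau]}(x,y)\}$. Strong localisability: let $U$ be an interval with $u$ an interior point, and $h>0$. A process $Y=\{Y(t):t\in U\}$ is strongly $h$-localisable at $u$ in $C(\mathbb R)$ (resp. $D(\mathbb R)$) with local form $Y_u'=\{Y_u'(t):t\in\mathbb R\}$ if $Y$ has a version in $C(U)$ (resp. $D(U)$), $Y_u'$ has a version in $C(\mathbb R)$ (resp. $D(\mathbb R)$), and, as $r\searrow0$, the random functions $t\mapsto(Y(u+rt)-Y(u))/r^h$ converge in distribution (weakly) to $Y_u'$ in $C(\mathbb R)$ with the metric $d$ (resp. in $D(\mathbb R)$ with the metric $d_S$); when $U\neq\mathbb R$ these random functions are defined on any compact interval $[a,b]$ for all small $r$, and convergence means convergence in distribution of the restrictions to every compact interval. Equality of strong local forms is equality in distribution. $X_u'(\cdot,u)$ denotes the local form at $u$ of $t\mapsto X(t,u)$. 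*)

(* Defs.v *)
From HB Require Import structures.
From mathcomp Require Import all_boot all_order all_algebra.
From mathcomp Require Import all_classical all_reals all_analysis.

Set Implicit Arguments.
Unset Strict Implicit.
Unset Printing Implicit Defensive.

Import Order.TTheory GRing.Theory Num.Theory.
Import numFieldNormedType.Exports.

Local Open Scope classical_set_scope.
Local Open Scope ring_scope.

(* Elements of C(A) and D(A) are represented by total functions R -> R of
   which only the values on A are constrained. *)

(* At a point of A with no point of A on its right (resp. left), the filter of
   the first (resp. second) condition is improper and the condition is void. *)
Definition cadlag (R : realType) (A : set R) (x : R -> R) : Prop :=
  forall t, A t ->
    (x s @[s --> within (A `&` [set s | t < s]) (nbhs t)] --> x t) /\
    (exists l : R, x s @[s --> within (A `&` [set s | s < t]) (nbhs t)] --> l).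

Variant path_class : Set := PathC | PathD.

Definition paths (R : realType) (F : path_class) (A : set R) : set (R -> R) :=
  match F with
  | PathC => [set x | {within A, continuous x}]
  | PathD => [set x | cadlag A x]
  end.

(* The distances take values in \bar R, so that no suprema or infima have junk
   values; they are finite on the path spaces below. *)
Definition sup_dist (R : realType) (A : set R) (x y : R -> R) : \bar R :=
  ereal_sup [set (`|x t - y t|)%:E | t in A].

Definition time_change (R : realType) (a b : R) (phi : R -> R) : Prop :=
  [/\ {in `[a, b] &, {homo phi : s t / s < t}},
      {within `[a, b], continuous phi} &
      set_bij `[a, b] `[a, b] phi].

Definition skorohod_dist (R : realType) (a b : R) (x y : R -> R) : \bar R :=
  ereal_inf [set delta%:E | delta in [set delta : R | 0 < delta /\
    exists phi : R -> R, [/\ time_change a b phi,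
      (sup_dist `[a, b] phi id <= delta%:E)%E &
      (sup_dist `[a, b] x (y \o phi) <= delta%:E)%E]]].

Definition compact_dist (R : realType) (F : path_class) (a b : R)
    (x y : R -> R) : \bar R :=
  match F with
  | PathC => sup_dist `[a, b] x y
  | PathD => skorohod_dist a b x y
  end.

Definition line_dist (R : realType) (F : path_class) (x y : R -> R) : \bar R :=
  (\sum_(1 <= k <oo)
    ((2^-1 ^+ k)%R%:E * mine 1 (compact_dist F (- k%:R) k%:R x y)))%E.

(* A functional on S that is continuous for dist takes the same value at two
   elements of S at distance 0; in particular, for S = paths F `[a, b] and
   dist = compact_dist F a b, it depends only on the restriction to [a, b]. *)
Definition bounded_continuous (R : realType) (S : set (R -> R))
    (dist : (R -> R) -> (R -> R) -> \bar R) (g : (R -> R) -> R) : Prop :=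
  (exists M : R, forall x, S x -> `|g x| <= M) /\
  (forall x, S x -> forall e : R, 0 < e -> exists2 delta : R, 0 < delta &
     forall y, S y -> (dist x y < delta%:E)%E -> `|g x - g y| < e).

(* Convergence in distribution, as r decreases to 0, of random elements Z r of
   S (for small r) to a random element Z' of S, possibly defined on another
   probability space. *)
Definition cvg_in_distribution (R : realType) (S : set (R -> R))
    (dist : (R -> R) -> (R -> R) -> \bar R)
    (d : measure_display) (T : measurableType d) (P : probability T R)
    (Z : R -> T -> R -> R)
    (d' : measure_display) (T' : measurableType d') (P' : probability T' R)
    (Z' : T' -> R -> R) : Prop :=
  forall g : (R -> R) -> R, bounded_continuous S dist g ->
    'E_P[fun w => g (Z r w)]%E @[r --> (0 : R)^'+] --> 'E_P'[fun w => g (Z' w)]%E.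

(* Processes indexed by A are families indexed by R whose members outside A
   are ignored. *)
Definition process (R : realType) (d : measure_display) (T : measurableType d)
    (A : set R) (Y : R -> T -> R) : Prop :=
  forall t, A t -> measurable_fun [set: T] (Y t).

Definition version_in (R : realType) (F : path_class) (A : set R)
    (d : measure_display) (T : measurableType d) (P : probability T R)
    (Y Y1 : R -> T -> R) : Prop :=
  [/\ process A Y1,
      forall t, A t -> {ae P, forall w, Y1 t w = Y t w} &
      forall w, paths F A (Y1 ^~ w)].

Definition rescaled (R : realType) (T : Type) (Y : R -> T -> R) (u h : R)
    (r : R) (w : T) (t : R) : R :=
  (Y (u + r * t) w - Y u w) / r `^ h.

Definition strongly_localisable (R : realType) (F : path_class)
    (d : measure_display) (T : measurableType d) (P : probability T R)
    (U : set R) (Y : R -> T -> R) (u h : R)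
    (d' : measure_display) (T' : measurableType d') (P' : probability T' R)
    (Y' : R -> T' -> R) : Prop :=
  exists (Y1 : R -> T -> R) (Y1' : R -> T' -> R),
    [/\ version_in F U P Y Y1,
        version_in F [set: R] P' Y' Y1',
        U = [set: R] ->
          cvg_in_distribution (paths F [set: R]) (line_dist F)
            P (rescaled Y1 u h) P' (fun w t => Y1' t w) &
        U <> [set: R] -> forall a b : R, a < b ->
          cvg_in_distribution (paths F `[a, b]) (compact_dist F a b)
            P (rescaled Y1 u h) P' (fun w t => Y1' t w)].

Definition increment_ratio_sup (R : realType) (T : Type) (X : R -> R -> T -> R)
    (u p : R) (A : set R) (w : T) : \bar R :=
  ereal_sup [set (`|X v v w - X v u w| / `|v - u| `^ p)%:E | v in A].

(* Main.v *)
Require Import Defs.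
From HB Require Import structures.
From mathcomp Require Import all_boot all_order all_algebra.
From mathcomp Require Import all_classical all_reals all_analysis.
From mathcomp Require Import measurable_realfun.
From mathcomp Require Import ring lra.

Set Implicit Arguments.
Unset Strict Implicit.
Unset Printing Implicit Defensive.

Import Order.TTheory GRing.Theory Num.Theory.
Import numFieldNormedType.Exports.

Local Open Scope classical_set_scope.
Local Open Scope ring_scope.

(** With [v = u + r t], the rescaled paths of [Y(t) = X(t, t)] and of [X(., u)]
    differ at [t] by [|X(v, v) - X(v, u)| / r^h], which is at most [c |t|^h] off
    the event that the increment ratio exceeds [c] near [u]. Hence the two are
    uniformly close on compacts with high probability, and a Slutsky argument
    applies: a bounded continuous functional is the increasing limit of its
    Lipschitz envelopes, whose expectations along both families of paths are
    close.

    This requires the functionals of the paths to be random variables. A path is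
    the limit, in the relevant distance, of paths determined by finitely many of
    its values rounded to a lattice, so a continuous functional of it is a limit
    of measurable functions with countably many values. In the Skorohod case, a
    cadlag path is cut into finitely many pieces of small oscillation, and a
    time change moves the cuts to grid points. Path regularity likewise reduces
    the supremum in the hypothesis to rational points. *)

(** * Path classes *)

(** Two gaps separate the hypotheses from the Slutsky argument. A continuous functional need not be
    uniformly continuous, so nearby paths need not give nearby values; a Lipschitz minorant repairs
    this at the price of a one-sided estimate, which is then applied to [- g] as well. And the
    assumed convergence concerns some version of [X(., u)], equal to it only almost surely at each
    fixed time; right continuity upgrades this to equality of whole paths near [u] off one null set.
    No sigma-algebra is placed on the path spaces. Convergence in distribution only tests bounded
    continuous functionals, and their measurability along a process is derived from that of its
    values at single times. *)

Lemma cvg_withinP (R : realType) (A : set R) (t l : R) (x : R -> R) :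
  (x s @[s --> within A (nbhs t)] --> l) <->
  forall e : R, 0 < e -> exists2 delta : R, 0 < delta &
    forall s, A s -> `|s - t| < delta -> `|x s - l| < e.
Proof.
split=> [/cvgrPdist_lt H e e0|H].
  have := H e e0; rewrite near_withinE => /nbhs_ballP[delta /= d0 Hd].
  exists delta => // s As st; rewrite distrC; apply: Hd => //.
  by rewrite /ball/= distrC.
apply/cvgrPdist_lt => e e0; rewrite near_withinE.
have [delta d0 Hd] := H e e0; apply/nbhs_ballP; exists delta => // s.
by rewrite /ball/= distrC => st As; rewrite distrC; exact: Hd.
Qed.

Lemma within_continuousP (R : realType) (A : set R) (x : R -> R) :
  {within A, continuous x} <->
  forall t, A t -> forall e : R, 0 < e -> exists2 delta : R, 0 < delta &
    forall s, A s -> `|s - t| < delta -> `|x s - x t| < e.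
Proof.
split=> [/subspace_continuousP H t At|H].
  exact/cvg_withinP/(H t At).
by apply/subspace_continuousP => t At; apply/cvg_withinP/H.
Qed.

Lemma cadlagP (R : realType) (A : set R) (x : R -> R) :
  cadlag A x <-> forall t, A t ->
    (forall e : R, 0 < e -> exists2 delta : R, 0 < delta &
       forall s, A s -> t < s < t + delta -> `|x s - x t| < e) /\
    (exists l : R, forall e : R, 0 < e -> exists2 delta : R, 0 < delta &
       forall s, A s -> t - delta < s < t -> `|x s - l| < e).
Proof.
split=> H t At; have [Hr [l Hl]] := H t At; split.
- move=> e e0; have /cvg_withinP/(_ e e0)[delta d0 Hd] := Hr.
  exists delta => // s As /andP[ts st]; apply: Hd => //.
  by rewrite ger0_norm; lra.
- exists l => e e0; have /cvg_withinP/(_ e e0)[delta d0 Hd] := Hl.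
  exists delta => // s As /andP[ts st]; apply: Hd => //.
  by rewrite ler0_norm; lra.
- apply/cvg_withinP => e e0; have [delta d0 Hd] := Hr e e0.
  exists delta => // s [As /= ts]; rewrite ltr_norml => /andP[_ st].
  by apply: Hd => //; apply/andP; split=> //; lra.
- exists l; apply/cvg_withinP => e e0; have [delta d0 Hd] := Hl e e0.
  exists delta => // s [As /= ts]; rewrite ltr_norml => /andP[st _].
  by apply: Hd => //; apply/andP; split=> //; lra.
Qed.

Lemma paths_sub (R : realType) (F : path_class) (A B : set R) (x : R -> R) :
  A `<=` B -> paths F B x -> paths F A x.
Proof.
case: F => AB /=.
  move=> /within_continuousP H; apply/within_continuousP => t At e e0.
  have [delta d0 Hd] := H t (AB _ At) e e0; exists delta => // s As; exact/Hd/AB.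
move=> /cadlagP H; apply/cadlagP => t At; have [Hr [l Hl]] := H t (AB _ At).
split=> [e e0|].
  have [delta d0 Hd] := Hr e e0; exists delta => // s As; exact/Hd/AB.
exists l => e e0.
have [delta d0 Hd] := Hl e e0; exists delta => // s As; exact/Hd/AB.
Qed.

(** The regularity that [C] and [D] share; every passage to rational times rests on it, so that
    these arguments need no case distinction. *)
Lemma paths_right_continuous (R : realType) (F : path_class) (A : set R)
    (x : R -> R) (t e : R) : paths F A x -> A t -> 0 < e ->
  exists2 delta : R, 0 < delta &
    forall s, A s -> t <= s < t + delta -> `|x s - x t| < e.
Proof.
move=> px At e0; case: F px => [/within_continuousP H|/cadlagP H].
  have [delta d0 Hd] := H t At e e0; exists delta => // s As /andP[ts st].
  by apply: Hd => //; rewrite ger0_norm; lra.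
have [/(_ e e0)[delta d0 Hd] _] := H t At; exists delta => // s As /andP[].
rewrite le_eqVlt => /predU1P[<-|ts] st; first by rewrite subrr normr0.
by apply: Hd; rewrite ?ts.
Qed.

Lemma paths_affine (R : realType) (F : path_class) (A B : set R) (x : R -> R)
    (u r k c : R) : 0 < r -> (forall t, A t -> B (u + r * t)) ->
  paths F B x -> paths F A (fun t => (x (u + r * t) - k) / c).
Proof.
move=> r0 AB.
(* The value map is Lipschitz with constant [|c^-1|]; adding 1 gives a positive constant to divide
   by, even for [c = 0], where [c^-1 = 0]. *)
have lip (y z e : R) : 0 < e -> `|y - z| < e * (`|c^-1| + 1)^-1 ->
    `|(y - k) / c - (z - k) / c| < e.
  move=> e0; rewrite -mulrBl opprB addrA subrK normrM => H.
  have c0 : 0 < `|c^-1| + 1 by rewrite ltr_wpDl.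
  rewrite ltr_pdivlMr// in H; apply: le_lt_trans H.
  by rewrite ler_wpM2l// lerDl.
have pos (e : R) : 0 < e -> 0 < e * (`|c^-1| + 1)^-1.
  by move=> e0; rewrite mulr_gt0// invr_gt0 ltr_wpDl.
case: F => [/within_continuousP H|/cadlagP H].
  apply/within_continuousP => t At e e0.
  have [delta d0 Hd] := H _ (AB _ At) _ (pos e e0).
  exists (delta / r) => [|s As st]; first exact: divr_gt0.
  apply: lip => //; apply: Hd; first exact: AB.
  rewrite opprD addrACA subrr add0r -mulrBr normrM gtr0_norm//.
  by rewrite mulrC -ltr_pdivlMr.
apply/cadlagP => t At; have [Hr [l Hl]] := H _ (AB _ At); split=> [e e0|].
  have [delta d0 Hd] := Hr _ (pos e e0).
  exists (delta / r) => [|s As /andP[ts st]]; first exact: divr_gt0.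
  apply: lip => //; apply: Hd; first exact: AB.
  rewrite ltrD2l ltr_pM2l// ts/= -addrA ltrD2l.
  by move: st; rewrite -(ltr_pM2l r0) mulrDr (mulrC _ (delta / r)) divfK ?gt_eqF.
exists ((l - k) / c) => e e0; have [delta d0 Hd] := Hl _ (pos e e0).
exists (delta / r) => [|s As /andP[ts st]]; first exact: divr_gt0.
apply: lip => //; apply: Hd; first exact: AB.
rewrite ltrD2l ltr_pM2l// st andbT -addrA ltrD2l.
by move: ts; rewrite -(ltr_pM2l r0) mulrBr (mulrC _ (delta / r)) divfK ?gt_eqF.
Qed.

(** * The distances are pseudometrics *)

(** Distinct functions may be at distance 0, since representatives are free outside the interval,
    and distances may be infinite. *)
Definition pseudometric (R : realType)
    (dist : (R -> R) -> (R -> R) -> \bar R) : Prop :=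
  [/\ forall x y, (0 <= dist x y)%E,
      forall x, dist x x = 0%E,
      forall x y, dist x y = dist y x &
      forall x y z, (dist x z <= dist x y + dist y z)%E].

Lemma sup_dist_le (R : realType) (A : set R) (x y : R -> R) (e : R) :
  (sup_dist A x y <= e%:E)%E <-> forall t, A t -> `|x t - y t| <= e.
Proof.
split=> [H t At|H].
  by rewrite -lee_fin; apply: le_trans H; apply: ereal_sup_ubound; exists t.
by apply: ge_ereal_sup => _ [t At <-]; rewrite lee_fin H.
Qed.

(** Over an empty set the supremum would be [-oo], which is negative. *)
Lemma pseudometric_sup_dist (R : realType) (A : set R) :
  A !=set0 -> pseudometric (sup_dist A).
Proof.
move=> [t0 At0].
have ge0 x y : (0 <= sup_dist A x y)%E.
  apply: (@le_trans _ _ (`|x t0 - y t0|)%:E); first by rewrite lee_fin.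
  by apply: ereal_sup_ubound; exists t0.
split=> //.
- move=> x; apply/eqP; rewrite eq_le ge0 andbT; apply/sup_dist_le => t _.
  by rewrite subrr normr0.
- by move=> x y; rewrite /sup_dist; under eq_fun do rewrite distrC.
- move=> x y z; apply: ge_ereal_sup => _ [t At <-].
  apply: (@le_trans _ _ ((`|x t - y t|)%:E + (`|y t - z t|)%:E)%E).
    by rewrite -EFinD lee_fin ler_distD.
  by apply: leeD; apply: ereal_sup_ubound; exists t.
Qed.

(** For an increasing map between segments surjectivity carries continuity, so this form of a time
    change is checked by order alone. Separate target endpoints let pieces be glued. *)
Definition inc_bij (R : realType) (a b a' b' : R) (phi : R -> R) : Prop :=
  [/\ forall s t, a <= s -> t <= b -> s < t -> phi s < phi t,
      phi a = a', phi b = b' &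
      forall y, a' <= y <= b' -> exists2 s, a <= s <= b & phi s = y].

Lemma inc_bij_in (R : realType) (a b a' b' : R) (phi : R -> R) (t : R) :
  inc_bij a b a' b' phi -> a <= t <= b -> a' <= phi t <= b'.
Proof.
move=> [inc <- <- _] /andP[ta tb]; apply/andP; split.
  move: ta; rewrite le_eqVlt => /predU1P[->//|ta]; apply/ltW/inc => //.
move: tb; rewrite le_eqVlt => /predU1P[->//|tb]; apply/ltW/inc => //.
Qed.

(** Endpoints are fixed: were [a] attained at some [s > a], then [phi a < a] would leave the
    segment; likewise at [b]. *)
Lemma inc_bij_time_change (R : realType) (a b : R) (phi : R -> R) :
  a <= b -> (time_change a b phi <-> inc_bij a b a b phi).
Proof.
move=> ab; split=> [[inc _ [fi inj surj]]|bij].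
  have inc' s t : a <= s -> t <= b -> s < t -> phi s < phi t.
    move=> sa tb st; apply: inc => //; rewrite in_itv/= ?sa ?tb ?andbT/=.
      exact: (le_trans (ltW st)).
    exact: (le_trans sa (ltW st)).
  have dom t : a <= t <= b -> a <= phi t <= b.
    by move=> tab; have := fi t; rewrite /= !in_itv/=; apply.
  have sj y : a <= y <= b -> exists2 s, a <= s <= b & phi s = y.
    move=> yab; have [|s] := surj y; first by rewrite /= in_itv.
    by rewrite /= in_itv/= => sab <-; exists s.
  split=> //.
    have [|s /andP[sa sb] sE] := sj a; first by rewrite lexx.
    move: sa; rewrite le_eqVlt => /predU1P[E|sa]; first by rewrite {1}E.
    have := dom a; rewrite lexx ab => /(_ isT)/andP[H _].
    by have := inc' a s (lexx a) sb sa; rewrite sE ltNge H.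
  have [|s /andP[sa sb] sE] := sj b; first by rewrite lexx ab.
  move: sb; rewrite le_eqVlt => /predU1P[E|sb]; first by rewrite -{1}E.
  have := dom b; rewrite lexx ab => /(_ isT)/andP[_ H].
  by have := inc' s b sa (lexx b) sb; rewrite sE ltNge H.
have [inc pa pb sj] := bij.
have homo : {in `[a, b] &, {homo phi : s t / s < t}}.
  move=> s t; rewrite !in_itv/= => /andP[sa _] /andP[_ tb]; exact: inc.
have mono := le_mono_in homo.
have surj : set_surj `[a, b] `[a, b] phi.
  move=> y /=; rewrite in_itv/= => /sj[s sab <-].
  by exists s; rewrite //= in_itv.
split=> //.
  by apply: segment_inc_surj_continuous => //; rewrite pa pb.
split=> //.
  move=> t /=; rewrite !in_itv/=; exact: (inc_bij_in bij).
by move=> s t; rewrite !inE => sab tab; apply: (inc_inj_in mono).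
Qed.

Lemma inc_bij_comp (R : realType) (a b a' b' a2 b2 : R) (phi psi : R -> R) :
  inc_bij a b a' b' phi -> inc_bij a' b' a2 b2 psi ->
  inc_bij a b a2 b2 (psi \o phi).
Proof.
move=> bphi bpsi; have [inc pa pb sj] := bphi.
have [inc' pa' pb' sj'] := bpsi; split=> /=.
- move=> s t sa tb st.
  have sab : a <= s <= b by rewrite sa (le_trans (ltW st)).
  have tab : a <= t <= b by rewrite tb (le_trans sa (ltW st)).
  have /andP[? _] := inc_bij_in bphi sab.
  have /andP[_ ?] := inc_bij_in bphi tab.
  by apply: inc' => //; exact: inc.
- by rewrite pa.
- by rewrite pb.
- move=> y /sj'[s /sj[t tab <-] <-]; by exists t.
Qed.

Lemma inc_bij_inv (R : realType) (a b a' b' : R) (phi : R -> R) :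
  a <= b -> inc_bij a b a' b' phi -> exists2 psi, inc_bij a' b' a b psi &
    forall s, a' <= s <= b' -> phi (psi s) = s.
Proof.
move=> ab bphi; have [inc pa pb sj] := bphi.
have inj s t : a <= s <= b -> a <= t <= b -> phi s = phi t -> s = t.
  move=> /andP[? ?] /andP[? ?] E; have [st|st|//] := ltgtP s t.
    by have := inc s t; rewrite E ltxx => H; suff: false by []; exact: H.
  by have := inc t s; rewrite E ltxx => H; suff: false by []; exact: H.
have /choice[psi Hpsi] : forall y, exists s,
    a' <= y <= b' -> a <= s <= b /\ phi s = y.
  move=> y; case: (pselect (a' <= y <= b')) => [/sj[s sab <-]|ny].
    by exists s.
  by exists 0 => /ny.
have /andP[aa' ab'] : a' <= phi a <= b' by apply: (inc_bij_in bphi); rewrite lexx.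
have psiK t : a <= t <= b -> psi (phi t) = t.
  move=> tab; have /Hpsi[? ?] := inc_bij_in bphi tab; exact: inj.
exists psi; last by move=> s /Hpsi[].
split.
- move=> s t sa tb st.
  have /Hpsi[/andP[s1 s2] sE] : a' <= s <= b' by rewrite sa (le_trans (ltW st)).
  have /Hpsi[/andP[t1 t2] tE] : a' <= t <= b' by rewrite tb (le_trans sa (ltW st)).
  rewrite ltNge le_eqVlt; apply/negP => /predU1P[E|lt].
    by move: st; rewrite -sE -tE E ltxx.
  by have := inc _ _ t1 s2 lt; rewrite sE tE ltNge (ltW st).
- by rewrite -pa psiK// lexx.
- by rewrite -pb psiK// lexx ab.
- move=> y yab; exists (phi y); first exact: inc_bij_in yab.
  exact: psiK.
Qed.

Definition skorohod_close (R : realType) (a b : R) (x y : R -> R) (e : R) :=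
  exists2 phi, inc_bij a b a b phi & forall t, a <= t <= b ->
    `|phi t - t| <= e /\ `|x t - y (phi t)| <= e.

Lemma skorohod_distE (R : realType) (a b : R) (x y : R -> R) : a <= b ->
  skorohod_dist a b x y =
  ereal_inf [set e%:E | e in [set e : R | 0 < e /\ skorohod_close a b x y e]].
Proof.
move=> ab; congr (ereal_inf (_ @` _)); apply/seteqP; split=> e [e0].
  move=> [phi [/(inc_bij_time_change phi ab) bphi /sup_dist_le H1 /sup_dist_le H2]].
  by split=> //; exists phi => // t tab; split; [apply: H1|apply: H2];
    rewrite /= in_itv.
move=> [phi bphi H]; split=> //; exists phi; split.
- exact/inc_bij_time_change.
- by apply/sup_dist_le => t; rewrite /= in_itv/= => /H[].
- by apply/sup_dist_le => t; rewrite /= in_itv/= => /H[].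
Qed.

Lemma skorohod_dist_le (R : realType) (a b : R) (x y : R -> R) (e : R) :
  a <= b -> 0 < e -> skorohod_close a b x y e ->
  (skorohod_dist a b x y <= e%:E)%E.
Proof. by move=> ab e0 H; rewrite skorohod_distE//; apply: ereal_inf_lbound; exists e. Qed.

(** The infimum over time changes need not be attained, so a witness is extracted only from a strict
    bound. *)
Lemma skorohod_dist_lt (R : realType) (a b : R) (x y : R -> R) (e : R) :
  a <= b -> (skorohod_dist a b x y < e%:E)%E ->
  exists e', [/\ 0 < e', e' < e & skorohod_close a b x y e'].
Proof.
move=> ab; rewrite skorohod_distE// => /ereal_inf_lt[_ [e' [e'0 H] <-]].
by rewrite lte_fin => lt; exists e'.
Qed.

Lemma skorohod_close_sym (R : realType) (a b : R) (x y : R -> R) (e : R) :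
  a <= b -> skorohod_close a b x y e -> skorohod_close a b y x e.
Proof.
move=> ab [phi bphi H]; have [psi bpsi K] := inc_bij_inv ab bphi.
exists psi => // t tab; have [H1 H2] := H _ (inc_bij_in bpsi tab).
by rewrite K// in H1 H2; rewrite distrC; split=> //; rewrite distrC.
Qed.

Lemma inc_bij_id (R : realType) (a b : R) : inc_bij a b a b id.
Proof. by split=> // y yab; exists y. Qed.

Lemma pseudometric_skorohod_dist (R : realType) (a b : R) :
  a <= b -> pseudometric (skorohod_dist a b).
Proof.
move=> ab.
have ge0 x y : (0 <= skorohod_dist a b x y)%E.
  rewrite skorohod_distE//; apply: le_ereal_inf_tmp => _ [e [e0 _] <-].
  by rewrite lee_fin ltW.
split=> //.
- move=> x; apply/eqP; rewrite eq_le ge0 andbT; apply/lee_addgt0Pr => e e0.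
  rewrite add0e; apply: skorohod_dist_le => //; exists id; first exact: inc_bij_id.
  by move=> t _; rewrite !subrr normr0 ltW.
- move=> x y; rewrite !skorohod_distE//; congr (ereal_inf (_ @` _)).
  by apply/seteqP; split=> e [e0 H]; split=> //; exact: skorohod_close_sym.
- move=> x y z; apply/lee_addgt0Pr => e e0.
  (* If one distance on the right is infinite, so is the sum, as neither is [-oo]. Otherwise
     near-optimal time changes, with slack [e / 2] each, are composed and their errors add up. *)
  case E1 : (skorohod_dist a b x y) (ge0 x y) => [r1| |] //= r10; last first.
    by rewrite !addye ?leey// gt_eqF// (lt_le_trans _ (ge0 _ _)) ?ltNyr.
  case E2 : (skorohod_dist a b y z) (ge0 y z) => [r2| |] //= r20; last first.
    by rewrite addey// addye// leey.
  have e2 : 0 < e / 2 by rewrite divr_gt0.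
  have [|e1 [e10 e1r [phi bphi H1]]] := @skorohod_dist_lt _ a b x y (r1 + e / 2) ab.
    by rewrite E1 lte_fin ltrDl.
  have [|e3 [e30 e3r [psi bpsi H2]]] := @skorohod_dist_lt _ a b y z (r2 + e / 2) ab.
    by rewrite E2 lte_fin ltrDl.
  apply: (@le_trans _ _ (e1 + e3)%:E); last by rewrite -!EFinD lee_fin; lra.
  apply: skorohod_dist_le; rewrite ?addr_gt0//.
  exists (psi \o phi); first exact: inc_bij_comp bpsi.
  move=> t tab /=; have [A1 A2] := H1 t tab.
  have [B1 B2] := H2 _ (inc_bij_in bphi tab); split.
    by rewrite (addrC e1); apply: le_trans (ler_distD (phi t) _ _) (lerD _ _).
  by apply: le_trans (ler_distD (y (phi t)) _ _) (lerD _ _).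
Qed.

Lemma pseudometric_compact_dist (R : realType) (F : path_class) (a b : R) :
  a <= b -> pseudometric (compact_dist F a b).
Proof.
case: F => ab; last exact: pseudometric_skorohod_dist.
by apply: pseudometric_sup_dist; exists a; rewrite /= in_itv/= lexx.
Qed.

Lemma compact_dist_le (R : realType) (F : path_class) (a b : R) (x y : R -> R)
    (e : R) : a <= b -> 0 < e -> (forall t, a <= t <= b -> `|x t - y t| <= e) ->
  (compact_dist F a b x y <= e%:E)%E.
Proof.
case: F => ab e0 H /=.
  by apply/sup_dist_le => t; rewrite /= in_itv; exact: H.
apply: skorohod_dist_le => //; exists id; first exact: inc_bij_id.
by move=> t tab; rewrite subrr normr0 ltW//; split=> //; exact: H.
Qed.

(** The weights up to [K] sum to at most 1, and those beyond [K] to [2^-K], where the truncation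
    bounds each distance by 1. *)
Lemma line_dist_le (R : realType) (F : path_class) (x y : R -> R) (K : nat)
    (e : R) : 0 <= e ->
  (forall k, (0 < k <= K)%N -> (compact_dist F (- k%:R) k%:R x y <= e%:E)%E) ->
  (line_dist F x y <= (e + 2^-1 ^+ K)%:E)%E.
Proof.
move=> e0 H.
have pd k : pseudometric (compact_dist F (- k%:R : R) k%:R).
  by apply: pseudometric_compact_dist; have := ler0n R k; lra.
have t0 k : (0 <= (2^-1 ^+ k)%R%:E * mine 1 (compact_dist F (- k%:R) k%:R x y))%E.
  have [ge0 _ _ _] := pd k.
  by rewrite mule_ge0// ?lee_fin ?exprn_ge0// le_min lee_fin ler01 ge0.
apply: lime_le.
  by apply: is_cvg_nneseries => k _ _; exact: t0.
apply: nearW => n.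
have bnd k : (0 < k)%N -> ((2^-1 ^+ k)%R%:E * mine 1 (compact_dist F (- k%:R) k%:R x y)
    <= (2^-1 ^+ k * (if (k <= K)%N then e else 1))%:E)%E.
  move=> k0; rewrite EFinM lee_pmul2l ?lte_fin ?exprn_gt0//.
  case: ifPn => kK; last by rewrite ge_min lexx.
  by rewrite ge_min H ?orbT// k0.
apply: (@le_trans _ _ (\sum_(1 <= k < n) (2^-1 ^+ k * (if (k <= K)%N then e else 1))%:E)%E).
  rewrite big_nat_cond [in leRHS]big_nat_cond; apply: lee_sum => k.
  by rewrite andbT => /andP[k0 _]; exact: bnd.
rewrite sumEFin lee_fin.
case: n => [|n]; first by rewrite big_geq// addr_ge0// exprn_ge0.
have h m : 0 <= (2^-1 : R) ^+ m by rewrite exprn_ge0.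
(* Invariant for the induction on [n]: exact up to [K]; beyond [K] the tail is exact and the part
   with factor [e] is enlarged. *)
have key : \sum_(1 <= k < n.+1) (2^-1 ^+ k * (if (k <= K)%N then e else 1)) <=
    e * (1 - 2^-1 ^+ n) + (if (n <= K)%N then 0 else 2^-1 ^+ K - 2^-1 ^+ n).
  elim: n => [|n IH]; first by rewrite big_geq// expr0 subrr mulr0 add0r.
  rewrite big_nat_recr//=; apply: le_trans (lerD IH (lexx _)) _.
  rewrite exprS; have := h n; set p := _ ^+ n => p0.
  case: (ltngtP n K) => [nK|Kn|nK].
  - nra.
  - nra.
  - rewrite -nK -/p; nra.
apply: le_trans key _; have := h n; have := h K.
set p := _ ^+ n; set q := _ ^+ K => q0 p0.
by case: ifP => _; nra.
Qed.

Lemma pseudometric_line_dist (R : realType) (F : path_class) :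
  pseudometric (@line_dist R F).
Proof.
have pd k : pseudometric (compact_dist F (- k%:R : R) k%:R).
  by apply: pseudometric_compact_dist; have := ler0n R k; lra.
have t0 k x y : (0 <= (2^-1 ^+ k)%R%:E * mine 1 (compact_dist F (- k%:R : R) k%:R x y))%E.
  have [ge0 _ _ _] := pd k.
  by rewrite mule_ge0// ?lee_fin ?exprn_ge0// le_min lee_fin ler01 ge0.
split=> [x y|x|x y|x y z].
- by apply: nneseries_ge0 => k _ _; exact: t0.
- apply: eseries0 => k _ _; have [_ -> _ _] := pd k.
  by rewrite min_r ?mule0// lee_fin.
- by apply: eq_eseriesr => k _; have [_ _ -> _] := pd k.
- rewrite -nneseriesD//; try by move=> k _ _; exact: t0.
  apply: lee_nneseries => [k _ _|k _]; first exact: t0.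
  have [ge0 _ _ tri] := pd k.
  have m0 x' y' : (0 <= mine 1 (compact_dist F (- k%:R : R) k%:R x' y'))%E.
    by rewrite le_min lee_fin ler01 ge0.
  rewrite -ge0_muleDr//; apply: lee_wpmul2l; first by rewrite lee_fin exprn_ge0.
  (* Truncation at 1 keeps the triangle inequality: once one summand reaches 1, so does the bound;
     otherwise neither summand is truncated. *)
  have [h1|h1] := leP 1%E (compact_dist F (- k%:R : R) k%:R x y).
    by apply: (@le_trans _ _ 1%E); rewrite ?ge_min ?lexx// leeDl.
  have [h2|h2] := leP 1%E (compact_dist F (- k%:R : R) k%:R y z).
    by apply: (@le_trans _ _ 1%E); rewrite ?ge_min ?lexx// leeDr.
  by rewrite ge_min tri orbT.
Qed.

(** * Convergence in distribution and closeness in probability *)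

Lemma near_right0P (R : realType) (Q : R -> Prop) :
  (\forall r \near (0 : R)^'+, Q r) <->
  exists2 delta : R, 0 < delta & forall r, 0 < r < delta -> Q r.
Proof.
rewrite /at_right near_withinE; split.
  move=> /nbhs_ballP[delta /= d0 H]; exists delta => // r /andP[r0 rd].
  by apply: H => //; rewrite /ball/= sub0r normrN gtr0_norm.
move=> [delta d0 H]; apply/nbhs_ballP; exists delta => // r.
by rewrite /ball/= sub0r normrN => rd r0; apply: H; rewrite r0 (le_lt_trans (ler_norm _) rd).
Qed.

Lemma cvge_right0P (R : realType) (f : R -> \bar R) (l : R) :
  (f r @[r --> (0 : R)^'+] --> l%:E) <->
  forall e : R, 0 < e -> exists2 delta : R, 0 < delta & forall r, 0 < r < delta ->
    f r \is a fin_num /\ `|fine (f r) - l| < e.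
Proof.
split=> [/fine_cvgP[/near_right0P[d1 d10 H1] /cvgrPdist_lt H2] e e0|H].
  have /near_right0P[d2 d20 {}H2] := H2 e e0.
  exists (Num.min d1 d2) => [|r]; first by rewrite lt_min d10.
  rewrite lt_min => /and3P[r0 r1 r2]; split; first by rewrite H1 ?r0.
  by rewrite distrC H2// r0.
apply/fine_cvgP; split.
  have [delta d0 Hd] := H 1 ltr01; apply/near_right0P; exists delta => // r.
  by move=> /Hd[].
apply/cvgrPdist_lt => e e0; have [delta d0 Hd] := H e e0.
by apply/near_right0P; exists delta => // r /Hd[_]; rewrite distrC.
Qed.

Lemma bounded_integrable (R : realType) (d : measure_display)
    (T : measurableType d) (P : probability T R) (f : T -> R) (M : R) :
  measurable_fun [set: T] f -> (forall w, `|f w| <= M) ->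
  P.-integrable [set: T] (EFin \o f).
Proof.
move=> mf fM; apply: measurable_bounded_integrable => //.
  by rewrite ltey_eq fin_num_measure.
by exists M; split; rewrite ?num_real // => x Mx y _ /=; rewrite (le_trans _ (ltW Mx)).
Qed.

Lemma bounded_expectation_fin_num (R : realType) (d : measure_display)
    (T : measurableType d) (P : probability T R) (f : T -> R) (M : R) :
  measurable_fun [set: T] f -> (forall w, `|f w| <= M) ->
  ('E_P[f])%E \is a fin_num.
Proof.
by move=> mf fM; rewrite unlock; apply: integrable_fin_num => //; exact: bounded_integrable fM.
Qed.

(** Integrate [f <= g + c + 2 * M * \1_B], which holds everywhere: on [B] because [f] and [g] differ
    by at most [2 * M]. *)
Lemma expectation_le_off_set (R : realType) (d : measure_display)
    (T : measurableType d) (P : probability T R) (f g : T -> R) (B : set T)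
    (M c p : R) : 0 <= M -> measurable_fun [set: T] f ->
  measurable_fun [set: T] g ->
  (forall w, `|f w| <= M) -> (forall w, `|g w| <= M) -> measurable B ->
  (P B <= p%:E)%E -> 0 <= c -> (forall w, ~ B w -> f w <= g w + c) ->
  fine 'E_P[f] <= fine 'E_P[g] + c + 2 * M * p.
Proof.
move=> M0 mf mg fM gM mB PB c0 H.
have PBfin : P B \is a fin_num by exact: fin_num_measure.
have mk : measurable_fun [set: T] (fun w => c + 2 * M * \1_B w : R).
  by apply: measurable_funD => //; apply: measurable_funM => //; exact: measurable_indic.
have kM w : `|c + 2 * M * \1_B w : R| <= c + 2 * M.
  rewrite indicE; case: (w \in B); rewrite /= ?mulr1 ?mulr0 ?addr0 ger0_norm//; lra.
have i1 := @bounded_integrable R d T P g M mg gM.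
have i2 := @bounded_integrable R d T P _ _ mk kM.
have Ek : (\int[P]_w ((fun w => c + 2 * M * \1_B w) w)%:E = (c + 2 * M * fine (P B))%:E)%E.
  under eq_integral do rewrite EFinD.
  rewrite integralD//; first last.
  - by apply: (@bounded_integrable _ _ _ P (fun w => 2 * M * \1_B w) (2 * M));
      [apply: measurable_funM => //; exact: measurable_indic|move=> w;
      rewrite indicE; case: (w \in B); rewrite /= ?mulr1 ?mulr0 ger0_norm//; lra].
  - exact: finite_measure_integrable_cst.
  rewrite integral_cst//= probability_setT mule1.
  under eq_integral do rewrite EFinM.
  rewrite integralZl//; last first.
    by apply: (@bounded_integrable _ _ _ P (\1_B) 1) => //= w;
      rewrite indicE; case: (w \in B); rewrite /= ?normr1 ?normr0.
  by rewrite integral_indic// setIT EFinD [in RHS]EFinM fineK.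
have le : ('E_P[f] <= 'E_P[g] + (c + 2 * M * fine (P B))%:E)%E.
  rewrite unlock -Ek -integralD//; apply: le_integral => //.
  - exact: bounded_integrable fM.
  - exact: integrableD.
  move=> w _; rewrite -EFinD lee_fin indicE; case: (boolP (w \in B)) => wB /=.
    rewrite mulr1; have := fM w; have := gM w; rewrite !ler_norml => /andP[? ?] /andP[? ?].
    lra.
  by rewrite mulr0 addr0; apply: H; move=> /mem_set; rewrite (negbTE wB).
have Ef := bounded_expectation_fin_num P mf fM.
have Eg := bounded_expectation_fin_num P mg gM.
rewrite -(fineK Ef) -(fineK Eg) -EFinD lee_fin in le.
apply: le_trans le _; rewrite -addrA lerD2l lerD2l ler_wpM2l//; first lra.
by rewrite -lee_fin fineK.
Qed.

(** A real-valued distance with the same small balls, fit to be multiplied by a Lipschitz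
    constant. *)
Definition trunc_dist (R : realType) (dist : (R -> R) -> (R -> R) -> \bar R)
    (x y : R -> R) : R := fine (mine 1 (dist x y))%E.

Lemma trunc_distE (R : realType) (dist : (R -> R) -> (R -> R) -> \bar R)
    (x y : R -> R) : pseudometric dist ->
  (trunc_dist dist x y)%:E = mine 1%E (dist x y).
Proof.
move=> [ge0 _ _ _]; rewrite /trunc_dist fineK// fin_numE.
have := ge0 x y; case: (dist x y) => [r| |] //= r0; last by rewrite min_l ?leey.
by rewrite /mine; case: ifP.
Qed.

Lemma trunc_dist_ge0 (R : realType) (dist : (R -> R) -> (R -> R) -> \bar R)
    (x y : R -> R) : pseudometric dist -> 0 <= trunc_dist dist x y.
Proof.
by move=> pd; rewrite -lee_fin trunc_distE// le_min lee_fin ler01; case: pd => ->.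
Qed.

Lemma trunc_dist_triangle (R : realType) (dist : (R -> R) -> (R -> R) -> \bar R)
    (x y z : R -> R) : pseudometric dist ->
  trunc_dist dist x z <= trunc_dist dist x y + trunc_dist dist y z.
Proof.
move=> pd; have [ge0 _ _ tri] := pd; rewrite -lee_fin EFinD !trunc_distE//.
have m0 x' y' : (0 <= mine 1 (dist x' y'))%E by rewrite le_min lee_fin ler01 ge0.
have [h1|h1] := leP 1%E (dist x y).
  by apply: (@le_trans _ _ 1%E); rewrite ?ge_min ?lexx// leeDl.
have [h2|h2] := leP 1%E (dist y z).
  by apply: (@le_trans _ _ 1%E); rewrite ?ge_min ?lexx// leeDr// ltW.
by rewrite ge_min tri orbT.
Qed.

Lemma trunc_dist_sym (R : realType) (dist : (R -> R) -> (R -> R) -> \bar R)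
    (x y : R -> R) : pseudometric dist -> trunc_dist dist x y = trunc_dist dist y x.
Proof. by move=> [_ _ sym _]; rewrite /trunc_dist sym. Qed.

Lemma trunc_dist_lt (R : realType) (dist : (R -> R) -> (R -> R) -> \bar R)
    (x y : R -> R) (e : R) : pseudometric dist -> 0 < e ->
  (dist x y < e%:E)%E -> trunc_dist dist x y < e.
Proof.
by move=> pd e0 H; rewrite -lte_fin trunc_distE// gt_min H orbT.
Qed.

Lemma trunc_dist_ge (R : realType) (dist : (R -> R) -> (R -> R) -> \bar R)
    (x y : R -> R) (e : R) : pseudometric dist -> e <= 1 ->
  (e%:E <= dist x y)%E -> e <= trunc_dist dist x y.
Proof.
by move=> pd e1 H; rewrite -lee_fin trunc_distE// le_min H lee_fin e1.
Qed.

(* Pasch-Hausdorff envelope: the greatest [k]-Lipschitz minorant of [g] on [S]. *)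
Definition lipschitz_envelope (R : realType) (S : set (R -> R))
    (dist : (R -> R) -> (R -> R) -> \bar R) (g : (R -> R) -> R) (k : nat)
    (x : R -> R) : R :=
  inf [set g y + k%:R * trunc_dist dist x y | y in S].

Lemma lipschitz_envelope_bounds (R : realType) (S : set (R -> R))
    (dist : (R -> R) -> (R -> R) -> \bar R) (g : (R -> R) -> R) (k : nat)
    (M : R) (x : R -> R) :
  pseudometric dist -> (forall x, S x -> `|g x| <= M) -> S x ->
  [/\ - M <= lipschitz_envelope S dist g k x,
      lipschitz_envelope S dist g k x <= g x &
      forall y, S y -> lipschitz_envelope S dist g k x <=
                       g y + k%:R * trunc_dist dist x y].
Proof.
move=> pd gM Sx; have lb y : S y -> - M <= g y + k%:R * trunc_dist dist x y.
  move=> Sy; have := gM y Sy; rewrite ler_norml => /andP[h _].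
  by apply: le_trans h _; rewrite lerDl mulr_ge0// trunc_dist_ge0.
have ub y : S y -> lipschitz_envelope S dist g k x <= g y + k%:R * trunc_dist dist x y.
  move=> Sy; apply: ge_inf; last by exists y.
  by exists (- M) => _ [z Sz <-]; exact: lb.
split=> //.
  apply: lb_le_inf; first by exists (g x + k%:R * trunc_dist dist x x); exists x.
  by move=> _ [z Sz <-]; exact: lb.
apply: le_trans (ub x Sx) _; rewrite /trunc_dist; case: pd => _ -> _ _.
by rewrite min_r ?lee_fin//= mulr0 addr0.
Qed.

Lemma lipschitz_envelope_lip (R : realType) (S : set (R -> R))
    (dist : (R -> R) -> (R -> R) -> \bar R) (g : (R -> R) -> R) (k : nat)
    (M : R) (x y : R -> R) :
  pseudometric dist -> (forall x, S x -> `|g x| <= M) -> S x -> S y ->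
  lipschitz_envelope S dist g k x <=
  lipschitz_envelope S dist g k y + k%:R * trunc_dist dist x y.
Proof.
move=> pd gM Sx Sy; rewrite -lerBlDr; apply: lb_le_inf.
  by exists (g y + k%:R * trunc_dist dist y y); exists y.
move=> _ [z Sz <-]; rewrite lerBlDr.
have [_ _ H] := lipschitz_envelope_bounds k pd gM Sx.
apply: le_trans (H z Sz) _; rewrite -addrA lerD2l -mulrDr ler_wpM2l//.
by rewrite addrC trunc_dist_triangle.
Qed.

Lemma lipschitz_envelope_continuous (R : realType) (S : set (R -> R))
    (dist : (R -> R) -> (R -> R) -> \bar R) (g : (R -> R) -> R) (k : nat) :
  pseudometric dist -> bounded_continuous S dist g ->
  bounded_continuous S dist (lipschitz_envelope S dist g k).
Proof.
move=> pd [[M gM] _]; split.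
  exists M => x Sx; have [h1 h2 _] := lipschitz_envelope_bounds k pd gM Sx.
  rewrite ler_norml h1/=; apply: le_trans h2 _.
  by have := gM x Sx; rewrite ler_norml => /andP[].
move=> x Sx e e0; exists (e / k.+1%:R) => [|y Sy xy]; first exact: divr_gt0.
have := trunc_dist_lt pd _ xy; rewrite divr_gt0// => /(_ isT).
rewrite ltr_pdivlMr// => lt.
have h1 := lipschitz_envelope_lip k pd gM Sx Sy.
have h2 := lipschitz_envelope_lip k pd gM Sy Sx.
rewrite (trunc_dist_sym _ _ pd) in h2.
have h3 := trunc_dist_ge0 x y pd.
have h4 : k%:R * trunc_dist dist x y < e.
  by apply: le_lt_trans lt; rewrite mulrC ler_wpM2l// ler_nat.
by rewrite ltr_norml; apply/andP; split; lra.
Qed.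

(** Points near [x] cannot bring the infimum below [g x - e], by continuity at [x]; all others pay a
    penalty proportional to [k], which eventually exceeds the total variation [2 * M] of [g]. *)
Lemma lipschitz_envelope_cvg (R : realType) (S : set (R -> R))
    (dist : (R -> R) -> (R -> R) -> \bar R) (g : (R -> R) -> R) (x : R -> R) :
  pseudometric dist -> bounded_continuous S dist g -> S x ->
  lipschitz_envelope S dist g k x @[k --> \oo] --> g x.
Proof.
move=> pd [[M gM] cg] Sx; apply/cvgrPdist_le => e e0.
have [delta d0 Hd] := cg x Sx e e0.
(* Capped at 1 because the truncated distance never exceeds 1. *)
pose e1 := Num.min delta 1; have e10 : 0 < e1 by rewrite lt_min d0 ltr01.
have M0 : 0 <= M by apply: le_trans (gM x Sx).
near=> k.
have [h1 h2 _] := lipschitz_envelope_bounds k pd gM Sx.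
rewrite ger0_norm ?subr_ge0// lerBlDr addrC -lerBlDr.
apply: lb_le_inf; first by exists (g x + k%:R * trunc_dist dist x x); exists x.
move=> _ [y Sy <-]; have t0 := trunc_dist_ge0 x y pd.
have [lt|ge] := ltP (dist x y) e1%:E.
  have := Hd y Sy _; rewrite ltr_norml => /(_ _)/andP[|_ h].
    by apply: lt_le_trans lt _; rewrite lee_fin ge_min lexx.
  have : 0 <= k%:R * trunc_dist dist x y by rewrite mulr_ge0.
  lra.
have := trunc_dist_ge pd _ ge; rewrite ge_min lexx orbT => /(_ isT) le.
have : 2 * M <= k%:R * trunc_dist dist x y.
  apply: (@le_trans _ _ (k%:R * e1)); last by rewrite ler_wpM2l.
  rewrite -ler_pdivrMr//; near: k; exact: nbhs_infty_ger.
have := gM x Sx; have := gM y Sy; rewrite !ler_norml => /andP[? ?] /andP[? ?]; lra.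
Unshelve. all: by end_near. Qed.

Lemma bounded_continuousN (R : realType) (S : set (R -> R))
    (dist : (R -> R) -> (R -> R) -> \bar R) (g : (R -> R) -> R) :
  bounded_continuous S dist g -> bounded_continuous S dist (fun x => - g x).
Proof.
move=> [[M gM] cg]; split; first by exists M => x Sx; rewrite normrN gM.
move=> x Sx e e0; have [delta d0 Hd] := cg x Sx e e0; exists delta => // y Sy xy.
by rewrite -opprD normrN; exact: Hd.
Qed.

(** Measurability is asked of exactly the functionals that convergence in distribution tests. *)
Definition random_element (R : realType) (S : set (R -> R))
    (dist : (R -> R) -> (R -> R) -> \bar R) (d : measure_display)
    (T : measurableType d) (Z : T -> R -> R) : Prop :=
  (forall w, S (Z w)) /\ forall g, bounded_continuous S dist g ->
    measurable_fun [set: T] (fun w => g (Z w)).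

(** Choose [k] from the limit alone so that the envelope [gk k] loses at most [e / 4] there.
    Convergence moves its expectation to [Z r], the Lipschitz bound moves it to [W r], and
    [gk k <= g] returns to [g]. This last step is why the bound is one-sided. *)
Lemma slutsky_lower (R : realType) (S : set (R -> R))
    (dist : (R -> R) -> (R -> R) -> \bar R)
    (d : measure_display) (T : measurableType d) (P : probability T R)
    (Z W : R -> T -> R -> R)
    (d' : measure_display) (T' : measurableType d') (P' : probability T' R)
    (Z' : T' -> R -> R) (g : (R -> R) -> R) (e delta : R) :
  pseudometric dist -> random_element S dist Z' -> 0 < delta ->
  (forall r, 0 < r < delta ->
     random_element S dist (Z r) /\ random_element S dist (W r)) ->
  (forall e p : R, 0 < e -> 0 < p -> exists2 delta : R, 0 < delta &
     forall r, 0 < r < delta -> exists B : set T, [/\ measurable B,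
       (P B <= p%:E)%E & forall w, ~ B w -> (dist (Z r w) (W r w) < e%:E)%E]) ->
  cvg_in_distribution S dist P Z P' Z' -> bounded_continuous S dist g -> 0 < e ->
  exists2 delta : R, 0 < delta & forall r, 0 < r < delta ->
    fine 'E_P'[fun w => g (Z' w)] < fine 'E_P[fun w => g (W r w)] + e.
Proof.
move=> pd [SZ' mZ'] d0 ZW close cvgZ bg e0; have [[M gM] cg] := bg.
pose gk := lipschitz_envelope S dist g.
have bgk k : bounded_continuous S dist (gk k) by exact: lipschitz_envelope_continuous.
have gkM k x : S x -> `|gk k x| <= M.
  move=> Sx; have [h1 h2 _] := lipschitz_envelope_bounds k pd gM Sx.
  rewrite ler_norml h1/=; apply: le_trans h2 _.
  by have := gM x Sx; rewrite ler_norml => /andP[].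
(* [M] bounds an absolute value at some path, since a space carrying a probability is nonempty. *)
have M0 : 0 <= M.
  have [w _] : [set: T'] !=set0.
    apply/set0P/negP => /eqP T0; have := probability_setT P'.
    by rewrite T0 measure0 => /eqP; rewrite lt_eqF// lte_fin.
  exact: le_trans (gM _ (SZ' w)).
have fin' f : bounded_continuous S dist f -> 'E_P'[fun w => f (Z' w)]%E \is a fin_num.
  move=> bf; have [[N fN] _] := bf.
  by apply: (bounded_expectation_fin_num P' (mZ' f bf)) => w; exact: fN.
have e4 : 0 < e / 4 by rewrite divr_gt0.
have [k Hk] : exists k,
    fine 'E_P'[fun w => g (Z' w)] < fine 'E_P'[fun w => gk k (Z' w)] + e / 4.
  have [|||||_ _] := @dominated_convergence _ _ _ P' [set: T'] measurableT
      (fun k w => (gk k (Z' w))%:E) (fun w => (g (Z' w))%:E) (cst M%:E).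
  - by move=> k; apply/measurable_EFinP/mZ'.
  - exact/measurable_EFinP/mZ'.
  - apply: aeW => w _; apply: cvg_EFin; first exact: nearW.
    exact: lipschitz_envelope_cvg.
  - exact: finite_measure_integrable_cst.
  - by apply: aeW => w k _; rewrite lee_fin gkM.
  move=> H; have : ('E_P'[fun w => gk k (Z' w)] @[k --> \oo] -->
      (fine 'E_P'[fun w => g (Z' w)])%:E)%E.
    by rewrite fineK ?fin'// unlock.
  move=> /fine_cvgP[_ /cvgrPdist_lt/(_ _ e4)[k _ /(_ k (leqnn _))]].
  by rewrite /= ltr_norml => /andP[_ lt]; exists k; lra.
have := cvgZ _ (bgk k); rewrite -(fineK (fin' _ (bgk k))).
move=> /cvge_right0P/(_ _ e4)[d1 d10 H1].
(* The Lipschitz error and the exceptional set cost at most [e / 4] each; [k.+1] and [2 * M + 1]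
   keep the denominators positive when [k] or [M] is 0. *)
have c0 : 0 < e / 4 / k.+1%:R by rewrite divr_gt0.
have p0 : 0 < e / 4 / (2 * M + 1) by rewrite divr_gt0//; lra.
have [d2 d20 H2] := close _ _ c0 p0.
exists (Num.min delta (Num.min d1 d2)) => [|r]; first by rewrite !lt_min d0 d10.
rewrite !lt_min => /and4P[r0 rd rd1 rd2].
have [|[SZ mZ] [SW mW]] := ZW r; first by rewrite r0.
have [|Efin] := H1 r; first by rewrite r0.
have [|B [mB PB HB]] := H2 r; first by rewrite r0.
rewrite ltr_norml => /andP[lt1 _].
have le1 : fine 'E_P[fun w => gk k (Z r w)] <=
    fine 'E_P[fun w => gk k (W r w)] + e / 4 + 2 * M * (e / 4 / (2 * M + 1)).
  apply: (@expectation_le_off_set _ _ _ P _ _ B) => //.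
  - exact: mZ.
  - exact: mW.
  - by move=> w; exact: gkM.
  - by move=> w; exact: gkM.
  - exact: ltW.
  - move=> w /HB lt; apply: le_trans (lipschitz_envelope_lip k pd gM (SZ w) (SW w)) _.
    rewrite lerD2l; have := trunc_dist_lt pd c0 lt; rewrite ltr_pdivlMr// => lt'.
    apply: ltW; apply: le_lt_trans lt'; rewrite mulrC ler_wpM2l ?trunc_dist_ge0//.
    by rewrite ler_nat.
have le2 : fine 'E_P[fun w => gk k (W r w)] <= fine 'E_P[fun w => g (W r w)] + 0 + 2 * M * 0.
  apply: (@expectation_le_off_set _ _ _ P _ _ set0) => //.
  - exact: mW.
  - exact: mW.
  - by move=> w; exact: gkM.
  - by move=> w; exact: gM.
  - by rewrite measure0.
  - by move=> w _; rewrite addr0; have [] := lipschitz_envelope_bounds k pd gM (SW w).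
have le3 : 2 * M * (e / 4 / (2 * M + 1)) <= e / 4.
  rewrite mulrCA ger_pMr// ler_pdivrMr; lra.
lra.
Qed.

(** The upper bound is the lower bound for [- g]. *)
Lemma slutsky (R : realType) (S : set (R -> R))
    (dist : (R -> R) -> (R -> R) -> \bar R)
    (d : measure_display) (T : measurableType d) (P : probability T R)
    (Z W : R -> T -> R -> R)
    (d' : measure_display) (T' : measurableType d') (P' : probability T' R)
    (Z' : T' -> R -> R) (delta : R) :
  pseudometric dist -> random_element S dist Z' -> 0 < delta ->
  (forall r, 0 < r < delta ->
     random_element S dist (Z r) /\ random_element S dist (W r)) ->
  (forall e p : R, 0 < e -> 0 < p -> exists2 delta : R, 0 < delta &
     forall r, 0 < r < delta -> exists B : set T, [/\ measurable B,
       (P B <= p%:E)%E & forall w, ~ B w -> (dist (Z r w) (W r w) < e%:E)%E]) ->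
  cvg_in_distribution S dist P Z P' Z' -> cvg_in_distribution S dist P W P' Z'.
Proof.
move=> pd rZ' d0 ZW close cvgZ g bg; have [[M gM] _] := bg.
have bNg := bounded_continuousN bg; have [SZ' mZ'] := rZ'.
have fin' : 'E_P'[fun w => g (Z' w)]%E \is a fin_num.
  by apply: (bounded_expectation_fin_num P' (mZ' g bg)) => w; exact: gM.
rewrite -(fineK fin'); apply/cvge_right0P => e e0.
have [d1 d10 H1] := slutsky_lower pd rZ' d0 ZW close cvgZ bg e0.
have [d2 d20 H2] := slutsky_lower pd rZ' d0 ZW close cvgZ bNg e0.
exists (Num.min delta (Num.min d1 d2)) => [|r]; first by rewrite !lt_min d0 d10.
rewrite !lt_min => /and4P[r0 rd rd1 rd2].
have [|_ [SW mW]] := ZW r; first by rewrite r0.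
split; first by apply: (bounded_expectation_fin_num P (mW g bg)) => w; exact: gM.
have expN d0' (T0 : measurableType d0') (P0 : probability T0 R) (V : T0 -> R -> R) :
    random_element S dist V ->
    fine 'E_P0[fun w => - g (V w)] = - fine 'E_P0[fun w => g (V w)].
  move=> [SV mV]; rewrite unlock; under eq_integral do rewrite EFinN.
  rewrite integralN ?fineN//; apply: integrable_add_def => //.
  by apply: (bounded_integrable P0 (mV g bg)) => w; exact: gM.
have := H1 r; rewrite r0 => /(_ rd1) lt1.
have := H2 r; rewrite r0 => /(_ rd2); rewrite !expN// => lt2.
by rewrite ltr_norml; apply/andP; split; lra.
Qed.

(** * Measurability of continuous functionals of paths *)

(** [h] is arbitrary: each preimage is a countable union of fibres of [f]. *)
Lemma measurable_fun_countable_comp (R : realType) (d : measure_display)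
    (T : measurableType d) (C : countType) (f : T -> C) (h : C -> R) :
  (forall c, measurable [set w | f w = c]) ->
  measurable_fun [set: T] (fun w => h (f w)).
Proof.
move=> mf _ B mB; rewrite setTI.
have -> : (fun w => h (f w)) @^-1` B = \bigcup_n
    (if unpickle n is Some c then
       (if pselect (B (h c)) then [set w | f w = c] else set0) else set0).
  apply/seteqP; split=> w /=.
    move=> Bw; exists (pickle (f w)) => //; rewrite pickleK.
    by case: pselect.
  move=> [n _]; case: unpickle => // c; case: pselect => // Bc /=.
  by move=> ->.
apply: bigcup_measurable => n _; case: unpickle => [c|//].
by case: pselect => ?; [exact: mf|exact: measurable0].
Qed.

(** Values rounded down to multiples of [1 / n.+1], stored as integers so that codes form a
    countable type. *)
Definition path_code (R : realType) (n : nat) (ts : seq R) (x : R -> R) :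
  seq int := [seq Num.floor (n.+1%:R * x t) | t <- ts].

Lemma measurable_path_code (R : realType) (d : measure_display)
    (T : measurableType d) (Z : T -> R -> R) (n : nat) (ts : seq R) (c : seq int) :
  (forall t, t \in ts -> measurable_fun [set: T] (fun w => Z w t)) ->
  measurable [set w | path_code n ts (Z w) = c].
Proof.
elim: ts c => [|t ts IH] c mZ.
  case: c => [|z c].
    by rewrite [X in measurable X](_ : _ = setT)//; apply/seteqP; split.
  by rewrite [X in measurable X](_ : _ = set0)//; apply/seteqP; split.
case: c => [|z c].
  by rewrite [X in measurable X](_ : _ = set0)//; apply/seteqP; split.
rewrite [X in measurable X](_ : _ =
    ([set: T] `&` (fun w => n.+1%:R * Z w t) @^-1` `[z%:~R, (z + 1)%:~R[) `&`
    [set w | path_code n ts (Z w) = c]).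
  apply: measurableI; last by apply: IH => s sts; apply: mZ; rewrite inE sts orbT.
  have mf : measurable_fun [set: T] (fun w => n.+1%:R * Z w t).
    by apply: measurable_funM => //; apply: mZ; rewrite inE eqxx.
  by apply: mf.
apply/seteqP; split=> w /=.
  move=> [zE cE]; split=> //; split=> //.
  by rewrite /= in_itv/= -zE floor_itv.
move=> [[_]]; rewrite /= in_itv/= => zE <-; congr (_ :: _).
exact: floor_def.
Qed.

(** [g] of the decoded path factors through the countable set of codes, so it is measurable however
    [Q] depends on the code; continuity of [g] at the path gives pointwise convergence. *)
Lemma random_element_approx (R : realType) (S : set (R -> R))
    (dist : (R -> R) -> (R -> R) -> \bar R) (d : measure_display)
    (T : measurableType d) (Z : T -> R -> R) (ts : nat -> seq R)
    (Q : nat -> seq int -> R -> R) :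
  (forall n c, S (Q n c)) ->
  (forall x, S x -> forall e : R, 0 < e -> exists N, forall n, (N <= n)%N ->
     (dist x (Q n (path_code n (ts n) x)) < e%:E)%E) ->
  (forall n t, t \in ts n -> measurable_fun [set: T] (fun w => Z w t)) ->
  (forall w, S (Z w)) -> random_element S dist Z.
Proof.
move=> SQ cvgQ mZ SZ; split=> // g [_ cg].
apply: (@measurable_fun_cvg _ _ _ _
  (fun n w => g (Q n (path_code n (ts n) (Z w))))).
  move=> n; apply: (measurable_fun_countable_comp
    (f := fun w => path_code n (ts n) (Z w)) (fun c => g (Q n c))) => c.
  by apply: measurable_path_code; exact: mZ.
move=> w _; apply/cvgrPdist_lt => e e0.
have [delta d0 Hd] := cg _ (SZ w) e e0.
have [N HN] := cvgQ _ (SZ w) delta d0.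
by exists N => // n /= Nn; apply: Hd => //; exact: HN.
Qed.

(** * Interpolation of paths from grid values *)

Definition hat (R : realType) (m s t : R) : R := Num.max 0 (2 * m - `|t - s|).

(** For [C], a weighted average with tents of half-width two steps, so that the weights sum to at
    least [m] on the grid range; the maximum with [m] keeps the quotient continuous elsewhere. For
    [D], a step function constant on cells closed on the left, and 0 before [a]. *)
Definition grid_path (R : realType) (F : path_class) (a m : R) (N : nat)
    (v : nat -> R) (t : R) : R :=
  match F with
  | PathC => (\sum_(j < N.+1) v j * hat m (a + m * j%:R) t) /
             Num.max m (\sum_(j < N.+1) hat m (a + m * j%:R) t)
  | PathD => if Num.floor ((t - a) / m) is Posz j then v j else 0
  end.

Lemma hat_ge0 (R : realType) (m s t : R) : 0 <= hat m s t.
Proof. by rewrite le_max lexx. Qed.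

Lemma hat_near (R : realType) (m s t : R) : `|t - s| <= m -> m <= hat m s t.
Proof. by move=> h; rewrite le_max; apply/orP; right; lra. Qed.

Lemma hat_far (R : realType) (m s t : R) : 2 * m < `|t - s| -> hat m s t = 0.
Proof. by move=> h; rewrite /hat max_l//; lra. Qed.

Lemma continuous_maxr (R : realType) (f g : R -> R) :
  continuous f -> continuous g -> continuous (fun t => Num.max (f t) (g t)).
Proof.
move=> cf cg t; rewrite /continuous_at; under eq_fun do rewrite maxr_absE.
rewrite maxr_absE; apply: cvgM; last exact: cvg_cst.
apply: cvgD; first by apply: cvgD; [exact: cf|exact: cg].
by apply: cvg_norm; apply: cvgB; [exact: cf|exact: cg].
Qed.

Lemma continuous_hat (R : realType) (m s : R) : continuous (hat m s).
Proof.
apply: continuous_maxr; first by move=> t; exact: cvg_cst.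
move=> t; apply: cvgB; first exact: cvg_cst.
by apply: cvg_norm; apply: cvgB; [exact: cvg_id|exact: cvg_cst].
Qed.

Lemma paths_grid_path (R : realType) (F : path_class) (a m : R) (N : nat)
    (v : nat -> R) : 0 < m -> paths F [set: R] (grid_path F a m N v).
Proof.
move=> m0; case: F.
  apply: continuous_subspaceT => t.
  apply: cvgM.
    apply: continuous_big; first exact: add_continuous.
    by move=> j _ s; apply: cvgM; [exact: cvg_cst|exact: continuous_hat].
  apply: cvgV; first by rewrite gt_eqF// lt_max m0.
  apply: (continuous_maxr (f := cst m)); first by move=> s; exact: cvg_cst.
  apply: continuous_big; first exact: add_continuous.
  by move=> j _; exact: continuous_hat.
pose f (i : int) := if i is Posz j then v j else 0.
suff H : cadlag [set: R] (fun t => f (Num.floor ((t - a) / m))) by [].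
apply/cadlagP => t _; set q := (t - a) / m; split=> [e e0|].
  exists (m * ((Num.floor q + 1)%:~R - q)) => [|s _ /andP[ts st]].
    by rewrite mulr_gt0// subr_gt0 floorD1_gt.
  suff -> : Num.floor ((s - a) / m) = Num.floor q by rewrite subrr normr0.
  have h1 := floor_le q.
  apply: floor_def; apply/andP; split.
    apply: le_trans h1 _; rewrite /q ler_pM2r ?invr_gt0//; lra.
  rewrite ltr_pdivrMr//; move: st; rewrite mulrBr {2}/q [m * (_ / m)]mulrC divfK ?gt_eqF//.
  rewrite [m * _]mulrC; lra.
(* At a grid point the left limit is the value of the preceding cell, so [ceil q - 1] replaces
   [floor q]. *)
exists (f (Num.ceil q - 1)) => e e0.
exists (m * (q - (Num.ceil q - 1)%:~R)) => [|s _ /andP[ts st]].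
  by rewrite mulr_gt0// subr_gt0 ceilB1_lt.
suff -> : Num.floor ((s - a) / m) = Num.ceil q - 1 by rewrite subrr normr0.
apply: floor_def; apply/andP; split; last first.
  rewrite subrK; apply: lt_le_trans (ceil_ge q).
  rewrite /q ltr_pM2r ?invr_gt0//; lra.
rewrite ler_pdivlMr//; move: ts; rewrite mulrBr {1}/q [m * (_ / m)]mulrC divfK ?gt_eqF//.
rewrite [m * _]mulrC; lra.
Qed.

(** An average of values within [e] of [x t] is within [e] of it, and tents centred farther than
    [2 * m] from [t] have weight 0. *)
Lemma grid_pathC_approx (R : realType) (x : R -> R) (a m e : R) (N : nat)
    (v : nat -> R) (t : R) : 0 < m -> a <= t <= a + m * N%:R ->
  (forall k, (k <= N)%N -> `|t - (a + m * k%:R)| <= 2 * m -> `|v k - x t| <= e) ->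
  `|x t - grid_path PathC a m N v t| <= e.
Proof.
move=> m0 /andP[ta tN] H /=; set W := \sum_(j < N.+1) hat m _ t.
have mW : m <= W.
  (* The last grid point before [t] lies within [m] of it, so its tent alone weighs at least [m]. *)
  have q0 : 0 <= (t - a) / m by rewrite divr_ge0//; lra.
  have /andP[k1 k2] := truncn_itv q0; set k := Num.truncn _ in k1 k2.
  rewrite ler_pdivlMr// in k1; rewrite ltr_pdivrMr// in k2.
  have kN : (k < N.+1)%N.
    rewrite ltnS -(ler_nat R) -(ler_pM2l m0); lra.
  rewrite /W (bigD1 (Ordinal kN))//=; apply: ler_wpDr.
    by apply: sumr_ge0 => j _; exact: hat_ge0.
  rewrite -[k.+1]addn1 natrD mulrDl mul1r in k2.
  by apply: hat_near; rewrite ler_norml; apply/andP; split; lra.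
rewrite max_r//; have W0 : 0 < W by exact: lt_le_trans mW.
rewrite -[x t](mulfK (lt0r_neq0 W0)) -mulrBl normrM [X in _ * X]gtr0_norm ?invr_gt0//.
rewrite ler_pdivrMr// /W mulr_sumr -sumrB mulr_sumr.
apply: le_trans (ler_norm_sum _ _ _) _; apply: ler_sum => j _.
rewrite -mulrBl normrM (ger0_norm (hat_ge0 _ _ _)).
have [le|lt] := leP `|t - (a + m * j%:R)| (2 * m).
  by rewrite ler_wpM2r ?hat_ge0// distrC H// -ltnS.
by rewrite hat_far// !mulr0.
Qed.

(** Real induction, playing the role of compactness: at the supremum of the points of [[a, b]]
    satisfying [Q], the hypothesis steps across it, so the supremum cannot stop short of [b]. *)
Lemma segment_induction (R : realType) (a b : R) (Q : R -> Prop) :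
  a <= b -> Q a ->
  (forall c, a <= c <= b -> exists2 delta : R, 0 < delta &
     forall c' d, a <= c' -> c - delta < c' <= c -> Q c' ->
       c <= d < c + delta -> d <= b -> Q d) ->
  Q b.
Proof.
move=> ab Qa H; pose A := [set c | a <= c <= b /\ Q c].
have A0 : A a by split; rewrite ?lexx.
have supA : has_sup A by split; [exists a|exists b => c [/andP[]]].
have ubA c : A c -> c <= sup A by exact: ub_le_sup supA.2 _.
have sb : a <= sup A <= b.
  by rewrite ubA//=; apply: sup_le_ub; [exists a|move=> c [/andP[]]].
have [delta d0 Hd] := H _ sb.
have [c [/andP[ac cb] Qc] lt] := sup_adherent d0 supA.
have cs : c <= sup A by apply: ubA; split; rewrite ?ac.
have step d : sup A <= d < sup A + delta -> d <= b -> Q d.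
  by apply: (Hd c); rewrite ?lt.
have [le|gt] := leP b (sup A + delta / 2).
  by apply: step => //; move: sb => /andP[_ ->] /=; lra.
have : A (sup A + delta / 2).
  split; first by apply/andP; split; move/andP: sb => [? ?]; lra.
  by apply: step; [apply/andP; split; lra|exact: ltW].
by move=> /ubA; lra.
Qed.

Lemma segment_uniform_continuous (R : realType) (a b : R) (x : R -> R) (e : R) :
  a <= b -> {within `[a, b], continuous x} -> 0 < e ->
  exists2 eta : R, 0 < eta & forall s t, a <= s <= b -> a <= t <= b ->
    `|s - t| < eta -> `|x s - x t| < e.
Proof.
move=> ab /within_continuousP H e0.
apply: (@segment_induction _ a b (fun c => exists2 eta : R, 0 < eta &
  forall s t, a <= s <= c -> a <= t <= c -> `|s - t| < eta -> `|x s - x t| < e)) => //.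
  exists 1 => // s t sa ta _; rewrite -(le_anti sa) -(le_anti ta) subrr normr0//.
move=> c cab; have e2 : 0 < e / 2 by rewrite divr_gt0.
have [|delta d0 Hd] := H c _ _ e2; first by rewrite /= in_itv.
have d2 : 0 < delta / 2 by rewrite divr_gt0.
(* With half of [delta], a point within [delta / 2] of one beyond [c'] still lies within [delta] of
   [c]. *)
exists (delta / 2) => // c' d ac' /andP[c'1 c'2] [eta eta0 Heta] /andP[d1 d3] db.
have close s t : a <= s <= d -> a <= t <= d -> c' < s -> `|s - t| < delta / 2 ->
    `|x s - x t| < e.
  move=> /andP[sa sd] /andP[ta td] cs; rewrite ltr_norml => /andP[st1 st2].
  have h1 : `|x s - x c| < e / 2.
    apply: Hd; first by rewrite /= in_itv/= sa (le_trans sd).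
    by rewrite ltr_norml; apply/andP; split; lra.
  have h2 : `|x t - x c| < e / 2.
    apply: Hd; first by rewrite /= in_itv/= ta (le_trans td).
    by rewrite ltr_norml; apply/andP; split; lra.
  by move: h1 h2; rewrite !ltr_norml => /andP[? ?] /andP[? ?]; apply/andP; split; lra.
exists (Num.min eta (delta / 2)) => [|s t sd td]; first by rewrite lt_min eta0.
rewrite lt_min => /andP[st1 st2].
have [sc|sc] := leP s c'; last exact: close.
have [tc|tc] := leP t c'; last by rewrite distrC; apply: close => //; rewrite distrC.
by apply: Heta => //; [move: sd|move: td] => /andP[-> _].
Qed.

(** Pieces are closed on the left and open on the right, so that jumps sit at cut points. Appending
    on the right suits both the segment induction and the gluing of time changes. *)
Inductive small_oscillation_chain (R : realType) (x : R -> R) (e a : R) :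
    R -> Prop :=
| chain_nil : small_oscillation_chain x e a a
| chain_snoc b c : small_oscillation_chain x e a b -> b < c ->
    (forall s t, b <= s < c -> b <= t < c -> `|x s - x t| <= e) ->
    small_oscillation_chain x e a c.

(** Around [c], the left limit controls [[c', c)] and right continuity controls [[c, d)]; [c] itself
    becomes a cut. *)
Lemma cadlag_chain (R : realType) (x : R -> R) (a b e : R) :
  a <= b -> cadlag `[a, b] x -> 0 < e -> small_oscillation_chain x e a b.
Proof.
move=> ab /cadlagP H e0.
apply: (@segment_induction _ a b); rewrite //; first exact: chain_nil.
move=> c cab; have e2 : 0 < e / 2 by rewrite divr_gt0.
have [|Hr [l Hl]] := H c; first by rewrite /= in_itv.
have [d1 d10 H1] := Hr _ e2; have [d2 d20 H2] := Hl _ e2.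
have {}Hr s : a <= s <= b -> c <= s < c + d1 -> `|x s - x c| < e / 2.
  move=> sab /andP[]; rewrite le_eqVlt => /predU1P[<-|cs] sc.
    by rewrite subrr normr0.
  by apply: H1; rewrite /= ?in_itv//= cs.
exists (Num.min d1 d2) => [|c' d ac' /andP[c'1 c'2] Qc' /andP[cd1 cd2] db].
  by rewrite lt_min d10.
have m1 : Num.min d1 d2 <= d1 by rewrite ge_min lexx.
have m2 : Num.min d1 d2 <= d2 by rewrite ge_min lexx orbT.
have Qc : small_oscillation_chain x e a c.
  move: c'2; rewrite le_eqVlt => /predU1P[<-//|c'c].
  apply: (chain_snoc Qc' c'c) => s t /andP[s1 s2] /andP[t1 t2].
  have h1 : `|x s - l| < e / 2.
    move/andP: cab => [? ?]; apply: H2; first by rewrite /= in_itv/=; apply/andP; split; lra.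
    by apply/andP; split; lra.
  have h2 : `|x t - l| < e / 2.
    move/andP: cab => [? ?]; apply: H2; first by rewrite /= in_itv/=; apply/andP; split; lra.
    by apply/andP; split; lra.
  move: h1 h2; rewrite !ltr_norml ler_norml => /andP[? ?] /andP[? ?].
  by apply/andP; split; lra.
move: cd1; rewrite le_eqVlt => /predU1P[<-//|cd1].
apply: (chain_snoc Qc cd1) => s t /andP[s1 s2] /andP[t1 t2].
have h1 : `|x s - x c| < e / 2.
  by move/andP: cab => [? ?]; apply: Hr; apply/andP; split; lra.
have h2 : `|x t - x c| < e / 2.
  by move/andP: cab => [? ?]; apply: Hr; apply/andP; split; lra.
move: h1 h2; rewrite !ltr_norml ler_norml => /andP[? ?] /andP[? ?].
by apply/andP; split; lra.
Qed.

Lemma inc_bij_glue (R : realType) (a b c a' b' c' : R) (phi psi : R -> R) :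
  a <= b -> b < c -> inc_bij a b a' b' phi -> inc_bij b c b' c' psi ->
  inc_bij a c a' c' (fun t => if t <= b then phi t else psi t).
Proof.
move=> ab bc bphi bpsi; have [i1 pa pb sj1] := bphi; have [i2 qb qc sj2] := bpsi.
split.
- move=> s t sa tc st; case: ifPn => sb; case: ifPn => tb.
  + exact: i1.
  + rewrite -ltNge in tb; have /andP[_ h] := inc_bij_in bphi (introT andP (conj sa sb)).
    by apply: le_lt_trans h _; rewrite -qb; exact: i2.
  + by move: sb; rewrite (le_trans (ltW st) tb).
  + by rewrite -ltNge in sb; apply: i2 => //; exact: ltW.
- by rewrite ab.
- by rewrite leNgt bc.
- move=> y /andP[y1 y2]; have [yb|yb] := leP y b'.
    have [|s /andP[s1 s2] <-] := sj1 y; first by rewrite y1.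
    by exists s; [rewrite s1 (le_trans s2 (ltW bc))|rewrite s2].
  have [|s /andP[s1 s2] sE] := sj2 y; first by rewrite (ltW yb).
  exists s; first by rewrite s2 (le_trans ab s1).
  case: ifPn => // sb; have E : s = b by apply/eqP; rewrite eq_le sb.
  by move: yb; rewrite -sE E qb ltxx.
Qed.

Definition affine_map (R : realType) (b c b' c' t : R) : R :=
  b' + (t - b) * ((c' - b') / (c - b)).

Lemma inc_bij_affine (R : realType) (b c b' c' : R) :
  b < c -> b' < c' -> inc_bij b c b' c' (affine_map b c b' c').
Proof.
move=> bc bc'; have k0 : 0 < (c' - b') / (c - b) by rewrite divr_gt0 ?subr_gt0.
have cb0 : c - b != 0 by rewrite subr_eq0 gt_eqF.
have cb0' : c' - b' != 0 by rewrite subr_eq0 gt_eqF.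
have endc : affine_map b c b' c' c = c' by rewrite /affine_map; field.
have mono s t : (affine_map b c b' c' s <= affine_map b c b' c' t) = (s <= t).
  by rewrite /affine_map lerD2l ler_pM2r// lerD2r.
split=> //.
- by move=> s t _ _ st; rewrite ltNge mono -ltNge.
- by rewrite /affine_map subrr mul0r addr0.
- move=> y yb; pose s := affine_map b' c' b c y.
  have sE : affine_map b c b' c' s = y.
    by rewrite /s /affine_map; field; rewrite cb0 cb0'.
  exists s => //; rewrite -(mono b) -(mono s c) sE endc.
  by rewrite {1}/affine_map subrr mul0r addr0.
Qed.

(** The displacement at [t] is a convex combination of the endpoint displacements, both in
    [[0, m]]. *)
Lemma affine_map_near (R : realType) (b c b' c' m t : R) :
  b < c -> b <= t <= c -> b <= b' <= b + m -> c <= c' <= c + m ->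
  `|affine_map b c b' c' t - t| <= m.
Proof.
move=> bc /andP[bt tc] /andP[b1 b2] /andP[c1 c2].
pose l := (t - b) / (c - b).
have cb0 : c - b != 0 by rewrite subr_eq0 gt_eqF.
have E : affine_map b c b' c' t - t = (1 - l) * (b' - b) + l * (c' - c).
  by rewrite /affine_map /l; field.
have l0 : 0 <= l by rewrite divr_ge0 ?subr_ge0 ?(ltW bc).
have l1 : l <= 1 by rewrite ler_pdivrMr ?subr_gt0// mul1r; lra.
rewrite E ger0_norm; nra.
Qed.

(* [kappa] and [tau] round up, resp. down, to a grid. The time change sends each
   cut point [c] of the chain to [kappa c], the first grid point after it, so
   that a path sampled at grid points never looks across a cut. *)
Lemma chain_time_change (R : realType) (x : R -> R) (a b e : R) :
  small_oscillation_chain x e a b ->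
  exists2 eta : R, 0 < eta & forall (m : R) (kappa tau : R -> R), m <= eta ->
    (forall c s, (kappa c <= s) = (c <= tau s)) ->
    (forall c, c <= kappa c <= c + m) -> kappa a = a ->
    exists2 phi, inc_bij a b a (kappa b) phi & forall t, a <= t <= b ->
      `|phi t - t| <= m /\ (t < b -> `|x t - x (tau (phi t))| <= e).
Proof.
move=> ch; suff [_] : a <= b /\ exists2 eta : R, 0 < eta &
    forall (m : R) (kappa tau : R -> R), m <= eta ->
    (forall c s, (kappa c <= s) = (c <= tau s)) ->
    (forall c, c <= kappa c <= c + m) -> kappa a = a ->
    exists2 phi, inc_bij a b a (kappa b) phi & forall t, a <= t <= b ->
      `|phi t - t| <= m /\ (t < b -> `|x t - x (tau (phi t))| <= e) by [].
elim: {b} ch => [|b c _ [ab [eta eta0 IH]] bc osc]; split.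
- exact: lexx.
- exists 1 => // m kappa tau m1 gal km ka; exists id; first by rewrite ka; exact: inc_bij_id.
  move=> t /andP[ta0 ta]; rewrite subrr normr0; split; last by rewrite ltNge ta0.
  by have /andP[] := km a; lra.
- exact: le_trans (ltW bc).
(* Half the length of the new piece: then [kappa b <= b + m < c <= kappa c], so the images of
   distinct cuts stay distinct. *)
exists (Num.min eta ((c - b) / 2)) => [|m kappa tau].
  by rewrite lt_min eta0 divr_gt0// subr_gt0.
rewrite le_min => /andP[m1 m2] gal km ka.
have [phi bphi Hphi] := IH m kappa tau m1 gal km ka.
have /andP[kb1 kb2] := km b; have /andP[kc1 kc2] := km c.
have kbc : kappa b < kappa c by lra.
have baff := inc_bij_affine bc kbc.
exists (fun t => if t <= b then phi t else affine_map b c (kappa b) (kappa c) t).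
  exact: inc_bij_glue baff.
have at_b : phi b = affine_map b c (kappa b) (kappa c) b.
  by have [_ _ -> _] := bphi; have [_ -> _ _] := baff.
have right t : b <= t <= c -> `|affine_map b c (kappa b) (kappa c) t - t| <= m /\
    (t < c -> `|x t - x (tau (affine_map b c (kappa b) (kappa c) t))| <= e).
  move=> /andP[bt tc]; split; first by apply: affine_map_near; rewrite ?bt ?kb1 ?kc1.
  move=> ltc; apply: osc; first by rewrite bt.
  have [inc q1 q2 _] := baff.
  have /andP[h1 _] := inc_bij_in baff (introT andP (conj bt tc)).
  (* By the Galois connection, [tau] of a point lies in [[b, c)] exactly when the point lies in
     [[kappa b, kappa c)]. *)
  rewrite -gal h1 ltNge -gal -ltNge /=.
  by have := inc t c bt (lexx c) ltc; rewrite q2.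
move=> t /andP[ta0 tc]; case: ifPn => tb.
  have [h1 h2] := Hphi t (introT andP (conj ta0 tb)).
  (* The earlier chain says nothing about the value at its end [b], which belongs to the next piece;
     the two maps agree there. *)
  split=> // _; move: tb; rewrite le_eqVlt => /predU1P[->|/h2//].
  by rewrite at_b; apply: (right b _).2 => //; rewrite lexx ltW.
by apply: right; rewrite tc andbT ltW// ltNge.
Qed.

(** The step path at [phi t] shows the value stored at [tau (phi t)]: one [e] pays for oscillation,
    one for rounding. Both ends must be grid points, for then [kappa] fixes them and [phi] maps the
    segment onto itself. *)
Lemma grid_pathD_approx (R : realType) (x : R -> R) (a b e : R) :
  a <= b -> cadlag `[a, b] x -> 0 < e ->
  exists2 eta : R, 0 < eta & forall (m a0 : R) (N i j : nat) (v : nat -> R),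
    0 < m <= eta -> a = a0 + m * i%:R -> b = a0 + m * j%:R ->
    (forall k, a <= a0 + m * k%:R <= b -> `|v k - x (a0 + m * k%:R)| <= e) ->
    (skorohod_dist a b x (grid_path PathD a0 m N v) <= (2 * e)%:E)%E.
Proof.
move=> ab cx e0; have [eta eta0 H] := chain_time_change (cadlag_chain ab cx e0).
exists (Num.min eta e) => [|m a0 N i j v]; first by rewrite lt_min eta0.
rewrite le_min => /and3P[m0 m1 m2] aE bE Hv.
pose kappa c := a0 + m * (Num.ceil ((c - a0) / m))%:~R.
pose tau s := a0 + m * (Num.floor ((s - a0) / m))%:~R.
have divE (z s : R) : (a0 + m * z <= s) = (z <= (s - a0) / m).
  by rewrite -lerBrDl mulrC ler_pdivlMr.
have divE' (z s : R) : (s <= a0 + m * z) = ((s - a0) / m <= z).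
  by rewrite -lerBlDl [m * _]mulrC ler_pdivrMr.
have gal c s : (kappa c <= s) = (c <= tau s).
  by rewrite /kappa /tau divE divE' -floor_ge_int ceil_le_int.
have km c : c <= kappa c <= c + m.
  rewrite /kappa divE' ceil_ge divE/=.
  have := ceilB1_lt ((c - a0) / m); rewrite intrB ltrBlDr => /ltW h.
  apply: le_trans h _; rewrite -[X in _ + X](divff (lt0r_neq0 m0)) -mulrDl.
  by rewrite ler_pM2r ?invr_gt0//; lra.
have kgrid (k : nat) : kappa (a0 + m * k%:R) = a0 + m * k%:R.
  have -> : kappa (a0 + m * k%:R) = a0 + m * (Num.ceil (k%:~R : R))%:~R.
    congr (a0 + m * (Num.ceil _)%:~R).
    by rewrite (addrC a0) addrK mulrC mulKf ?gt_eqF.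
  by rewrite intrKceil.
have ka : kappa a = a by rewrite aE kgrid.
have kb : kappa b = b by rewrite bE kgrid.
have [phi bphi Hphi] := H m kappa tau m1 gal km ka.
rewrite kb in bphi.
apply: skorohod_dist_le => //; first by rewrite mulr_gt0.
exists phi => // t tab; have [h1 h2] := Hphi t tab; split; first by lra.
have /andP[pa pb] := inc_bij_in bphi tab.
have tau_le s : tau s <= s by rewrite /tau divE floor_le.
have taua : a <= tau (phi t) by rewrite -gal ka.
have taub : tau (phi t) <= b by exact: le_trans (tau_le _) pb.
have {}h2 : `|x t - x (tau (phi t))| <= e.
  (* At [t = b] the oscillation bound is silent, but [b] is a grid point fixed by [phi], so
     [tau (phi b) = b]. *)
  move: tab => /andP[_]; rewrite le_eqVlt => /predU1P[tE|/h2//].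
  suff -> : tau (phi t) = t by rewrite subrr normr0 ltW.
  apply/eqP; rewrite tE in taub *; rewrite eq_le taub/= -gal kb.
  by have [_ _ -> _] := bphi.
have q0 : 0 <= (phi t - a0) / m.
  rewrite divr_ge0// ?subr_ge0 ?(ltW m0)//; apply: le_trans pa.
  by rewrite aE lerDl mulr_ge0// ltW.
have : 0 <= Num.floor ((phi t - a0) / m) by rewrite floor_ge0.
rewrite /grid_path; case E : (Num.floor ((phi t - a0) / m)) => [k|k] // _.
have tauE : tau (phi t) = a0 + m * k%:R by rewrite /tau E.
rewrite tauE in h2 taua taub.
have h3 := Hv k (introT andP (conj taua taub)).
move: h2 h3; rewrite !ler_norml => /andP[? ?] /andP[? ?].
by apply/andP; split; lra.
Qed.

(** The larger segment [[a', b']] provides for tents centred outside [[a, b]], up to two steps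
    away. *)
Lemma grid_path_approx (R : realType) (F : path_class) (x : R -> R)
    (a' b' a b e : R) :
  a' <= a -> a <= b -> b <= b' -> paths F `[a', b'] x -> 0 < e ->
  exists2 eta : R, 0 < eta & forall (m a0 : R) (N i j : nat) (v : nat -> R),
    0 < m <= eta -> a = a0 + m * i%:R -> b = a0 + m * j%:R -> (j <= N)%N ->
    (forall k, (k <= N)%N -> a - 2 * m <= a0 + m * k%:R <= b + 2 * m ->
       a' <= a0 + m * k%:R <= b' /\ `|v k - x (a0 + m * k%:R)| <= e) ->
    (compact_dist F a b x (grid_path F a0 m N v) <= (2 * e)%:E)%E.
Proof.
move=> aa' ab bb' px e0; case: F px => px; last first.
  have [|eta eta0 H] := @grid_pathD_approx _ x a b e ab _ e0.
    apply: (@paths_sub _ PathD _ _ _ _ px) => t.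
    by rewrite /= !in_itv/= => /andP[? ?]; apply/andP; split; lra.
  exists eta => // m a0 N i j v /andP[m0 meta] aE bE jN Hv.
  apply: (H m a0 N i j) => // [|k /andP[k1 k2]]; first by rewrite m0.
  have kN : (k <= N)%N.
    by apply: leq_trans jN; rewrite -(ler_nat R) -(ler_pM2l m0); move: k2; rewrite bE; lra.
  by have [|//] := Hv k kN; apply/andP; split; lra.
have ab' : a' <= b' by lra.
have [eta eta0 H] := segment_uniform_continuous ab' px e0.
(* Relevant grid points are at distance at most [2 * m < 3 * m <= eta]. *)
exists (eta / 3) => [|m a0 N i j v /andP[m0 meta] aE bE jN Hv]; first by rewrite divr_gt0.
apply: compact_dist_le => //; first by rewrite mulr_gt0.
move=> t /andP[ta tb]; apply: grid_pathC_approx => //.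
  apply/andP; split.
    by apply: le_trans ta; rewrite aE lerDl mulr_ge0// ltW.
  by apply: le_trans tb _; rewrite bE lerD2l ler_pM2l// ler_nat.
move=> k kN; rewrite ler_norml => /andP[k1 k2].
have [|tk h1] := Hv k kN; first by apply/andP; split; lra.
have h2 : `|x (a0 + m * k%:R) - x t| < e.
  by apply: H => //; [apply/andP; split; lra|rewrite ltr_norml; apply/andP; split; lra].
move: h1 h2; rewrite !ler_norml ltr_norml => /andP[? ?] /andP[? ?].
by apply/andP; split; lra.
Qed.

(** * Measurability through coded grid values *)

Definition grid_points (R : realType) (a m : R) (N : nat) : seq R :=
  [seq a + m * k%:R | k <- iota 0 N.+1].

Definition decode_path (R : realType) (F : path_class) (a m : R) (N n : nat)
    (c : seq int) : R -> R :=
  grid_path F a m N (fun k => (nth 0 c k)%:~R / n.+1%:R).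

Lemma path_code_near (R : realType) (x : R -> R) (a m : R) (N n k : nat) :
  (k <= N)%N ->
  `|(nth 0 (path_code n (grid_points a m N) x) k)%:~R / n.+1%:R -
    x (a + m * k%:R)| <= n.+1%:R^-1.
Proof.
move=> kN; rewrite /path_code /grid_points -map_comp.
rewrite (nth_map 0%N) ?size_iota// nth_iota// add0n /=.
set y := x _; have n0 : (0 : R) < n.+1%:R by [].
have /andP[h1 h2] := floor_itv (n.+1%:R * y); set z := Num.floor _ in h1 h2 *.
rewrite -[y in X in X <= _](mulKf (lt0r_neq0 n0)) mulrC -mulrBr normrM gtr0_norm ?invr_gt0//.
rewrite ger_pMr ?invr_gt0//; rewrite intrD in h2.
by rewrite ler_norml; apply/andP; split; lra.
Qed.

Lemma nat_eventually_ge (R : realType) (C : R) :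
  exists N, forall n, (N <= n)%N -> C <= n.+1%:R.
Proof.
exists (Num.truncn C) => n Nn; apply: le_trans (ltW (truncnS_gt C)) _.
by rewrite ler_nat.
Qed.

Lemma inv_nat_eventually_le (R : realType) (e : R) : 0 < e ->
  exists N, forall n, (N <= n)%N -> n.+1%:R^-1 <= e.
Proof.
move=> e0; have [N HN] := nat_eventually_ge e^-1; exists N => n /HN h.
by rewrite invf_ple ?posrE.
Qed.

Lemma random_element_compact (R : realType) (F : path_class) (a b : R)
    (d : measure_display) (T : measurableType d) (Z : T -> R -> R) :
  a < b -> (forall t, a <= t <= b -> measurable_fun [set: T] (fun w => Z w t)) ->
  (forall w, paths F `[a, b] (Z w)) ->
  random_element (paths F `[a, b]) (compact_dist F a b) Z.
Proof.
move=> ab mZ SZ; pose m n := (b - a) / n.+1%:R.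
have m0 n : 0 < m n by rewrite divr_gt0// subr_gt0.
have mb n : b = a + m n * n.+1%:R by rewrite /m divfK// addrC subrK.
have tk n k : (k <= n.+1)%N -> a <= a + m n * k%:R <= b.
  move=> kn; rewrite lerDl mulr_ge0 ?(ltW (m0 n))//= [leRHS](mb n) lerD2l.
  by rewrite ler_pM2l// ler_nat.
apply: (@random_element_approx _ _ _ _ _ _ (fun n => grid_points a (m n) n.+1)
  (fun n => decode_path F a (m n) n.+1 n)) => //.
- by move=> n c; apply: (@paths_sub _ F _ [set: R]) => //; exact: paths_grid_path.
- move=> x Sx e e0; have e4 : 0 < e / 4 by rewrite divr_gt0.
  have [eta eta0 H] := grid_path_approx (lexx a) (ltW ab) (lexx b) Sx e4.
  have [N1 HN1] := inv_nat_eventually_le e4.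
  have [|N2 HN2] := @inv_nat_eventually_le _ (eta / (b - a)).
    by rewrite divr_gt0// subr_gt0.
  exists (maxn N1 N2) => n; rewrite geq_max => /andP[/HN1 n1 /HN2 n2].
  apply: (@le_lt_trans _ _ (2 * (e / 4))%:E); last by rewrite lte_fin; lra.
  apply: (H (m n) a n.+1 0%N n.+1) => //.
  + by rewrite m0/= /m mulrC -ler_pdivlMr// subr_gt0.
  + by rewrite mulr0 addr0.
  + move=> k kn _; split; first exact: tk.
    exact: le_trans (path_code_near _ _ _ _ kn) n1.
- move=> n t /mapP[k]; rewrite mem_iota => /andP[_ kn] ->.
  by apply: mZ; apply: tk.
Qed.

Lemma eventually_uniform (Q : nat -> nat -> Prop) :
  (forall k, exists N, forall n, (N <= n)%N -> Q k n) ->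
  forall K, exists N, forall k n, (k <= K)%N -> (N <= n)%N -> Q k n.
Proof.
move=> H; elim=> [|K [N HN]].
  by have [N HN] := H 0%N; exists N => k n; rewrite leqn0 => /eqP->; exact: HN.
have [M HM] := H K.+1; exists (maxn N M) => k n kK; rewrite geq_max => /andP[Nn Mn].
by move: kK; rewrite leq_eqVlt => /predU1P[->|]; [exact: HM|rewrite ltnS => kK; exact: HN].
Qed.

Lemma expr_half_lt (R : realType) (e : R) : 0 < e -> exists K, (2^-1 : R) ^+ K < e.
Proof.
move=> e0; have [K HK] := inv_nat_eventually_le e0; exists K.+1.
apply: lt_le_trans (HK K (leqnn _)).
by rewrite exprVn ltf_pV2 ?posrE ?exprn_gt0// -natrX ltr_nat ltn_expl.
Qed.

(** One grid serves all [[-k, k]] with [k <= n]: mesh [1 / n.+1] starting from [- n.+1] passes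
    through every integer, so the endpoints are grid points. Segments beyond some [K] only
    contribute the tail [2^-K]. *)
Lemma random_element_line (R : realType) (F : path_class)
    (d : measure_display) (T : measurableType d) (Z : T -> R -> R) :
  (forall t, measurable_fun [set: T] (fun w => Z w t)) ->
  (forall w, paths F [set: R] (Z w)) ->
  random_element (paths F [set: R]) (line_dist F) Z.
Proof.
move=> mZ SZ.
apply: (@random_element_approx _ _ _ _ _ _
  (fun n => grid_points (- n.+1%:R) n.+1%:R^-1 (2 * (n.+1 * n.+1)))
  (fun n => decode_path F (- n.+1%:R) n.+1%:R^-1 (2 * (n.+1 * n.+1)) n)) => //.
- by move=> n c; apply: paths_grid_path; rewrite invr_gt0.
- move=> x Sx e e0; have e4 : 0 < e / 4 by rewrite divr_gt0.
  have [K HK] := expr_half_lt e4.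
  have [] := @eventually_uniform (fun k n => (compact_dist F (- k%:R) k%:R x
    (decode_path F (- n.+1%:R) n.+1%:R^-1 (2 * (n.+1 * n.+1)) n (path_code n
       (grid_points (- n.+1%:R) n.+1%:R^-1 (2 * (n.+1 * n.+1))) x))
     <= (2 * (e / 4))%:E)%E) _ K; last first.
    move=> N HN; exists N => n Nn; apply: (@le_lt_trans _ _ (2 * (e / 4) + 2^-1 ^+ K)%:E).
      by apply: line_dist_le => [|k /andP[_ kK]]; [lra|exact: HN].
    by rewrite lte_fin; lra.
  move=> k; have k0 : (0 : R) <= k%:R by [].
  (* One unit of margin on each side contains the tents' centres, as [2 * m <= 1] from [N3] on. *)
  have [||||eta eta0 H] := @grid_path_approx _ F x (- k%:R - 1) (k%:R + 1)
      (- k%:R) k%:R _ _ _ _ _ e4; [lra|lra|lra|exact: paths_sub Sx|].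
  have [N1 HN1] := inv_nat_eventually_le e4.
  have [N2 HN2] := inv_nat_eventually_le eta0.
  have [|N3 HN3] := @inv_nat_eventually_le R (1 / 2); first by lra.
  exists (maxn k (maxn N1 (maxn N2 N3))) => n.
  rewrite !geq_max => /and4P[kn /HN1 n1 /HN2 n2 /HN3 n3].
  have n0 : (n.+1%:R : R) != 0 by rewrite pnatr_eq0.
  apply: (H _ _ _ ((n.+1 - k) * n.+1)%N ((n.+1 + k) * n.+1)%N).
  + by rewrite invr_gt0 ltr0n.
  + by rewrite natrM natrB ?(leqW kn)//; field; rewrite addrC natr1.
  + by rewrite natrM natrD; field; rewrite addrC natr1.
  + by rewrite mulnA leq_mul2r mul2n -addnn leq_add2l (leqW kn) orbT.
  + move=> j jN /andP[j1 j2]; split.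
      move: j1 j2 n3; set y := (- n.+1%:R + _); set p := _^-1 => j1 j2 n3.
      by apply/andP; split; lra.
    exact: le_trans (path_code_near _ _ _ _ jN) n1.
Qed.

(** * The increment ratio near u *)

Lemma ae_forall_rat (R : realType) (d : measure_display) (T : measurableType d)
    (P : probability T R) (Q : rat -> T -> Prop) :
  (forall q, {ae P, forall w, Q q w}) -> {ae P, forall w, forall q, Q q w}.
Proof.
move=> H; have : {ae P, forall w, forall n,
    if @unpickle rat n is Some q then Q q w else True}.
  by apply: ae_foralln => n; case: unpickle => [q|]; [exact: H|exact: aeW].
apply: filterS => w Hw q; have := Hw (pickle q); by rewrite pickleK.
Qed.

Lemma rat_between (R : realType) (s t : R) : s < t ->
  exists q : rat, s < ratr q < t.
Proof. by move=> /rat_in_itvoo[q]; rewrite in_itv/= => h; exists q. Qed.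

(** Rationals approach [t] from the right, where both paths are right continuous. *)
Lemma paths_eq_on_ball (R : realType) (F : path_class) (U : set R)
    (x y : R -> R) (u e0 : R) :
  (forall t, `|t - u| < e0 -> U t) -> paths F U x -> paths F U y ->
  (forall q : rat, `|ratr q - u| < e0 -> x (ratr q) = y (ratr q)) ->
  forall t, `|t - u| < e0 -> x t = y t.
Proof.
move=> HU px py H t tu; apply/eqP; rewrite -subr_eq0 -normr_eq0 eq_le normr_ge0 andbT.
apply/ler_addgt0Pr => e e0'; rewrite add0r.
have e2 : 0 < e / 2 by rewrite divr_gt0.
have [d1 d10 H1] := paths_right_continuous px (HU _ tu) e2.
have [d2 d20 H2] := paths_right_continuous py (HU _ tu) e2.
have h0 : 0 < e0 - `|t - u| by rewrite subr_gt0.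
have [|q /andP[q1 q2]] := @rat_between _ t (t + Num.min (e0 - `|t - u|) (Num.min d1 d2)).
  by rewrite ltrDl !lt_min h0 d10.
move: q2; rewrite -ltrBlDl !lt_min => /and3P[q2 q3 q4].
have qu : `|ratr q - u| < e0.
  apply: le_lt_trans (ler_distD t _ _) _; rewrite ger0_norm; lra.
have := H1 _ (HU _ qu); have := H2 _ (HU _ qu); rewrite (H q qu) (ltW q1)/=.
rewrite -!ltrBlDl => /(_ q4) + /(_ q3); rewrite !ltr_norml ler_norml.
by move=> /andP[? ?] /andP[? ?]; apply/andP; split; lra.
Qed.

Lemma continuous_dist_powR (R : realType) (u h v e : R) : v != u -> 0 < e ->
  exists2 delta : R, 0 < delta & forall s, `|s - v| < delta ->
    `| `|s - u| `^ h - `|v - u| `^ h | < e.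
Proof.
move=> vu e0.
have : (fun s => `|s - u| `^ h) s @[s --> v] --> `|v - u| `^ h.
  apply: (@cvg_comp _ _ _ (fun s => `|s - u|) (fun z => z `^ h) _ (nbhs `|v - u|)).
    by apply: cvg_norm; apply: cvgB; [exact: cvg_id|exact: cvg_cst].
  have : derivable (fun z => z `^ h) `|v - u| 1.
    by apply: derivable_powR; rewrite in_itv/= andbT normr_gt0 subr_eq0.
  by move=> /derivable1_diffP/differentiable_continuous.
move=> /cvgrPdist_lt/(_ e e0)/nbhs_ballP[delta /= d0 H]; exists delta => // s sv.
by rewrite distrC; apply: H; rewrite /ball/= distrC.
Qed.

Lemma increment_ratio_sup_gt (R : realType) (T : Type) (X : R -> R -> T -> R)
    (u p c : R) (A : set R) (w : T) : u \notin A ->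
  (c%:E < increment_ratio_sup X u p A w)%E <->
  exists2 v, A v & c * `|v - u| `^ p < `|X v v w - X v u w|.
Proof.
move=> uA; have pos v : A v -> 0 < `|v - u| `^ p.
  move=> Av; rewrite powR_gt0// normr_gt0 subr_eq0; apply/eqP => vu.
  by move: uA; rewrite -vu mem_set.
split=> [/ereal_sup_gt[_ [v Av <-]]|[v Av lt]].
  by rewrite lte_fin ltr_pdivlMr ?pos// => lt; exists v.
apply: (@lt_le_trans _ _ (`|X v v w - X v u w| / `|v - u| `^ p)%:E).
  by rewrite lte_fin ltr_pdivlMr ?pos.
by apply: ereal_sup_ubound; exists v.
Qed.

Definition large_increment (R : realType) (T : Type) (X : R -> R -> T -> R)
    (U : set R) (u h c e : R) : set T :=
  [set w | (c%:E < increment_ratio_sup X u h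
                     [set v | (U v /\ 0 < `|v - u| < e)%R] w)%E].

Lemma large_incrementP (R : realType) (T : Type) (X : R -> R -> T -> R)
    (U : set R) (u h c e : R) (w : T) :
  large_increment X U u h c e w <->
  exists2 v, U v /\ 0 < `|v - u| < e & c * `|v - u| `^ h < `|X v v w - X v u w|.
Proof.
apply: increment_ratio_sup_gt; apply/negP; rewrite inE /= => -[_].
by rewrite subrr normr0 ltxx.
Qed.

(** The strict inequality survives moving [v] slightly to the right onto a rational, so the event is
    a countable union over rationals. *)
Lemma measurable_large_increment (R : realType) (F : path_class)
    (d : measure_display) (T : measurableType d) (U : set R) (u h e0 : R)
    (X : R -> R -> T -> R) (c e : R) :
  (forall t, `|t - u| < e0 -> U t) -> U u ->
  (forall t v, U t -> U v -> measurable_fun [set: T] (X t v)) ->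
  (forall w, paths F U (fun t => X t u w)) ->
  (forall w, paths F U (fun t => X t t w)) ->
  0 < c -> e <= e0 -> measurable (large_increment X U u h c e).
Proof.
move=> HU Uu mX pXu pX c0 ee0.
have -> : large_increment X U u h c e = \bigcup_(q : rat)
    (if 0 < `|ratr q - u| < e then
      [set: T] `&` (fun w => `|X (ratr q) (ratr q) w - X (ratr q) u w|) @^-1`
        `]c * `|ratr q - u| `^ h, +oo[ else set0).
  apply/seteqP; split=> [w /large_incrementP[v [Uv /andP[v0 ve] lt]]|w [q _]]; last first.
    case: ifPn => // q0 [_]; rewrite /= in_itv/= andbT => lt.
    apply/large_incrementP; exists (ratr q) => //; split=> //.
    by apply: HU; move/andP: q0 => [_ /lt_le_trans]; apply.
  (* Each of the two paths may move by [gap / 4] and the threshold by [gap / 2]. Staying closer to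
     [v] than [|v - u|] keeps the rational away from [u]. *)
  pose gap := `|X v v w - X v u w| - c * `|v - u| `^ h.
  have gap0 : 0 < gap by rewrite subr_gt0.
  have g4 : 0 < gap / 4 by rewrite divr_gt0.
  have gc : 0 < gap / 2 / c by rewrite !divr_gt0.
  have vu : v != u by rewrite -subr_eq0 -normr_gt0.
  have [d1 d10 H1] := paths_right_continuous (pXu w) Uv g4.
  have [d2 d20 H2] := paths_right_continuous (pX w) Uv g4.
  have [d3 d30 H3] := continuous_dist_powR h vu gc.
  have h0 : 0 < e - `|v - u| by rewrite subr_gt0.
  have [|q /andP[q1 q2]] := @rat_between _ v
      (v + Num.min (Num.min (e - `|v - u|) `|v - u|) (Num.min d1 (Num.min d2 d3))).
    by rewrite ltrDl !lt_min h0 v0 d10 d20.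
  move: q2; rewrite -ltrBlDl !lt_min => /and3P[/andP[q2 q3] q4 /andP[q5 q6]].
  have dq : `|ratr q - v| = ratr q - v by rewrite ger0_norm; lra.
  have qe : `|ratr q - u| < e.
    by apply: le_lt_trans (ler_distD v _ _) _; rewrite dq; lra.
  have q0 : 0 < `|ratr q - u|.
    have := ler_distD (ratr q) v u; rewrite (distrC v (ratr q)) dq; lra.
  exists q => //; rewrite q0 qe; split=> //; rewrite /= in_itv/= andbT.
  have Uq : U (ratr q) by apply: HU; exact: lt_le_trans ee0.
  have := H1 _ Uq; rewrite (ltW q1) -ltrBlDl => /(_ q4) k1.
  have := H2 _ Uq; rewrite (ltW q1) -ltrBlDl => /(_ q5) k2.
  have := H3 (ratr q); rewrite dq => /(_ q6).
  rewrite ltr_pdivlMr// => k3.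
  have k4 : c * `|ratr q - u| `^ h < c * `|v - u| `^ h + gap / 2.
    rewrite -ltrBlDl -mulrBr mulrC; apply: le_lt_trans k3.
    by rewrite ler_wpM2r ?(ltW c0)// ler_norm.
  have k5 : `|X v v w - X v u w| <= `|X (ratr q) (ratr q) w - X (ratr q) u w| + gap / 2.
    have -> : X v v w - X v u w = (X (ratr q) (ratr q) w - X (ratr q) u w) +
        ((X v v w - X (ratr q) (ratr q) w) + (X (ratr q) u w - X v u w)) by ring.
    apply: le_trans (ler_normD _ _) _; rewrite lerD2l.
    apply: le_trans (ler_normD _ _) _; rewrite distrC; lra.
  rewrite /gap in k4 k5; rewrite /gap in gap0; lra.
apply: bigcupT_measurable_rat => q; case: ifPn => // /andP[q0 qe].
have Uq : U (ratr q) by apply: HU; exact: lt_le_trans ee0.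
have mf : measurable_fun [set: T] (fun w => `|X (ratr q) (ratr q) w - X (ratr q) u w|).
  by apply: measurableT_comp => //; apply: measurable_funB; exact: mX.
by apply: mf.
Qed.

(** The exceptional set joins the large increment event and the null set where the version differs
    from [X(., u)] at some rational near [u]. *)
Lemma rescaled_close (R : realType) (F : path_class)
    (d : measure_display) (T : measurableType d) (P : probability T R)
    (U : set R) (u h e0 : R) (X : R -> R -> T -> R) (Y : R -> T -> R) :
  0 < h -> 0 < e0 -> (forall t, `|t - u| < e0 -> U t) ->
  (forall t v, U t -> U v -> measurable_fun [set: T] (X t v)) ->
  (forall w, paths F U (fun t => X t u w)) ->
  (forall w, paths F U (fun t => X t t w)) ->
  version_in F U P (fun t => X t u) Y ->
  (forall c : R, 0 < c ->
     P (large_increment X U u h c e) @[e --> (0 : R)^'+] --> 0%E) ->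
  forall K e p : R, 0 < K -> 0 < e -> 0 < p -> exists2 delta : R, 0 < delta &
    forall r, 0 < r < delta -> exists B : set T, [/\ measurable B,
      (P B <= p%:E)%E & forall w, ~ B w -> forall t, `|t| <= K ->
        `|rescaled Y u h r w t - rescaled (fun t => X t t) u h r w t| <= e].
Proof.
move=> h0 e00 HU mX pXu pX [mY YX pY] H K e p K0 ep p0.
have Uu : U u by apply: HU; rewrite subrr normr0.
have [N [mN PN HN]] : {ae P, forall w, forall q : rat, `|ratr q - u| < e0 ->
    Y (ratr q) w = X (ratr q) u w}.
  apply: ae_forall_rat => q; have [qu|qu] := ltP `|ratr q - u| e0.
    by apply: filterS (YX _ (HU _ qu)) => w ->.
  exact: aeW.
have YE w : ~ N w -> forall t, `|t - u| < e0 -> Y t w = X t u w.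
  move=> Nw; apply: (paths_eq_on_ball HU (pY w) (pXu w)).
  by apply: contra_notP Nw => nw; exact: HN.
(* As [|v - u| = r * |t|] with [|t| <= K], an increment of at most [c * |v - u| ^ h] is at most
   [e * r ^ h]. *)
pose c := e / K `^ h.
have Kh : 0 < K `^ h by exact: powR_gt0.
have c0 : 0 < c by rewrite divr_gt0.
have /cvge_right0P/(_ p p0)[d1 d10 H1] := H c c0.
(* The radius [r * (K + 1)] strictly exceeds [r * |t|], as the open ball in the event demands. *)
have K10 : 0 < K + 1 by rewrite addr_gt0.
exists (Num.min d1 e0 / (K + 1)) => [|r /andP[r0]].
  by rewrite divr_gt0// lt_min d10.
rewrite ltr_pdivlMr// lt_min => /andP[rd1 re0].
pose f := r * (K + 1); have f0 : 0 < f by rewrite mulr_gt0.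
have mE : measurable (large_increment X U u h c f).
  exact: measurable_large_increment HU Uu mX pXu pX c0 (ltW re0).
exists (large_increment X U u h c f `|` N); split; first exact: measurableU.
  apply: (@le_trans _ _ (P (large_increment X U u h c f) + P N)%E).
    exact: measureU2.
  have [|_] := H1 f; first by rewrite f0 rd1.
  rewrite PN adde0 subr0 ltr_norml => /andP[_ lt].
  by rewrite -[leLHS]fineK ?fin_num_measure// lee_fin ltW.
move=> w Bw t tK.
have Nw : ~ N w by move=> Nw; apply: Bw; right.
have Ew : ~ large_increment X U u h c f w by move=> Ew; apply: Bw; left.
have rh : 0 < r `^ h by exact: powR_gt0.
have vuE : u + r * t - u = r * t by rewrite addrC addKr.
have vn : `|u + r * t - u| = r * `|t| by rewrite vuE normrM gtr0_norm.
have vf : `|u + r * t - u| < f.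
  by rewrite vn ltr_pM2l//; lra.
have ve : `|u + r * t - u| < e0 by exact: lt_trans vf re0.
rewrite /rescaled (YE w Nw _ ve) (YE w Nw u) ?subrr ?normr0//.
set v := u + r * t in vn vf ve *.
rewrite -mulrBl opprB addrA subrK normrM [X in _ * X]gtr0_norm ?invr_gt0//.
rewrite ler_pdivrMr// distrC.
(* The event excludes [v = u], but there both rescaled paths vanish. *)
have [tE|t0] := eqVneq t 0.
  by rewrite /v tE mulr0 addr0 subrr normr0 mulr_ge0 ?ltW.
have v0 : 0 < `|v - u| by rewrite vn mulr_gt0// normr_gt0.
have le : `|X v v w - X v u w| <= c * `|v - u| `^ h.
  rewrite leNgt; apply/negP => lt; apply: Ew; apply/large_incrementP.
  by exists v => //; split; [exact: HU|rewrite v0].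
apply: le_trans le _; rewrite vn powRM ?(ltW r0)//.
rewrite (mulrC (r `^ h)) mulrA ler_pM2r// /c -mulrA ger_pMr//.
rewrite mulrC ler_pdivrMr// mul1r.
by apply: ge0_ler_powR; rewrite ?nnegrE//; exact: ltW.
Qed.

(** The events decrease with [e]. On their intersection some [v] arbitrarily close to [u] satisfy
    [c * |v - u| ^ h < M * |v - u| ^ eta], impossible since [|v - u| ^ (eta - h)] tends to 0. So the
    intersection is null, and continuity from above applies. *)
Lemma cvg_probability_large_increment (R : realType) (F : path_class)
    (d : measure_display) (T : measurableType d) (P : probability T R)
    (U : set R) (u h eta e0 : R) (X : R -> R -> T -> R) :
  h < eta -> 0 < e0 -> (forall t, `|t - u| < e0 -> U t) ->
  (forall t v, U t -> U v -> measurable_fun [set: T] (X t v)) ->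
  (forall w, paths F U (fun t => X t u w)) ->
  (forall w, paths F U (fun t => X t t w)) ->
  {ae P, forall w, (increment_ratio_sup X u eta
                      [set v | (U v /\ v != u)%R] w < +oo)%E} ->
  forall c : R, 0 < c ->
    P (large_increment X U u h c e) @[e --> (0 : R)^'+] --> 0%E.
Proof.
move=> he e00 HU mX pXu pX [N [mN PN HN]] c c0.
have Uu : U u by apply: HU; rewrite subrr normr0.
pose E := large_increment X U u h c.
have mE e : e <= e0 -> measurable (E e).
  exact: measurable_large_increment HU Uu mX pXu pX c0.
have subE e e' : e <= e' -> E e `<=` E e'.
  move=> ee' w /large_incrementP[v [Uv /andP[v0 ve]] lt]; apply/large_incrementP.
  by exists v => //; rewrite v0 (lt_le_trans ve).
pose en n := e0 / n.+1%:R.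
have en0 n : 0 < en n by rewrite divr_gt0.
have ene n : en n <= e0 by rewrite ler_pdivrMr// ler_peMr ?(ltW e00)// ler1n.
have PI0 : P (\bigcap_n E (en n)) = 0%E.
  apply: (@subset_measure0 _ _ _ _ _ N) => //.
    by apply: bigcapT_measurable => n; exact: mE.
  move=> w Ew; apply: contrapT => Nw.
  have : (increment_ratio_sup X u eta [set v | (U v /\ v != u)%R] w < +oo)%E.
    by apply: contrapT => nfin; apply: Nw; exact: HN.
  set s := increment_ratio_sup _ _ _ _ _ => sfin.
  have [M M0 sM] : exists2 M : R, 0 < M & (s <= M%:E)%E.
    case: s sfin => [r _|lt|_]; [|by rewrite ltxx in lt|by exists 1; rewrite ?leNye ?ltr01].
    by exists (`|r| + 1); [rewrite ltr_wpDl|rewrite lee_fin ler_wpDr// ler_norm].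
  have bound v : U v -> v != u -> `|X v v w - X v u w| <= M * `|v - u| `^ eta.
    move=> Uv vu; rewrite leNgt; apply/negP => lt.
    have : (M%:E < s)%E.
      by apply/increment_ratio_sup_gt; [apply/negP; rewrite inE /= => -[_]; rewrite eqxx|exists v].
    by rewrite ltNge sM.
  have eh : 0 < eta - h by rewrite subr_gt0.
  have /cvgrPdist_lt/(_ _ (divr_gt0 c0 M0))/near_right0P[delta d0 Hd] := powR_cvg0 eh.
  have [n Hn] := @inv_nat_eventually_le _ (delta / e0) (divr_gt0 d0 e00).
  have := Ew n I; move=> /large_incrementP[v [Uv /andP[v0 ve]]]; apply/negP; rewrite -leNgt.
  have vu : v != u by rewrite -subr_eq0 -normr_gt0.
  apply: le_trans (bound v Uv vu) _.
  rewrite -[eta](subrK h) powRD; last by apply/implyP => _; rewrite gt_eqF.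
  rewrite mulrA ler_pM2r ?powR_gt0//.
  have vd : `|v - u| < delta.
    apply: lt_le_trans ve _; have := Hn n (leqnn n).
    by rewrite ler_pdivlMr// mulrC.
  have := Hd `|v - u|; rewrite v0 vd => /(_ isT).
  rewrite sub0r normrN ger0_norm ?powR_ge0// ltr_pdivlMr// mulrC.
  exact: ltW.
have cvgE : P (E (en n)) @[n --> \oo] --> 0%E.
  rewrite -PI0; apply: (@nonincreasing_cvg_mu _ _ _ P (fun n => E (en n))) => //.
  + by rewrite ltey_eq fin_num_measure//; exact: mE.
  + by move=> n; exact: mE.
  + by apply: bigcapT_measurable => n; exact: mE.
  + move=> n m nm; apply/subsetPset/subE; rewrite ler_pM2l// lef_pV2 ?posrE//.
    by rewrite ler_nat.
apply/cvge_right0P => e ep.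
have /fine_cvgP[_ /cvgrPdist_lt/(_ e ep)[n _ /(_ n (leqnn n))]] := cvgE.
rewrite /= sub0r normrN => Pn; exists (en n) => // r /andP[r0 rn].
have re0 : r <= e0 by apply: le_trans (ltW rn) (ene n).
have fE e' : e' <= e0 -> P (E e') \is a fin_num.
  by move=> ee'; rewrite fin_num_measure//; exact: mE.
split; first exact: fE.
rewrite subr0; apply: le_lt_trans Pn.
rewrite !ger0_norm ?fine_ge0//; apply: fine_le; rewrite ?fE//.
by apply: le_measure; rewrite ?inE; [exact: mE|exact: mE|exact: subE (ltW rn)].
Qed.

(** * Localisability of the diagonal process *)

Lemma measurable_rescaled (R : realType) (d : measure_display)
    (T : measurableType d) (U : set R) (Y : R -> T -> R) (u h r t : R) :
  process U Y -> U u -> U (u + r * t) ->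
  measurable_fun [set: T] (fun w => rescaled Y u h r w t).
Proof.
move=> mY Uu Ut; apply: measurable_funM => //.
by apply: measurable_funB; exact: mY.
Qed.

Lemma strongly_localisable_diagonal (R : realType) (F : path_class)
    (d : measure_display) (T : measurableType d) (P : probability T R)
    (d' : measure_display) (T' : measurableType d') (P' : probability T' R)
    (U : set R) (u h e0 : R) (X : R -> R -> T -> R) (Xu' : R -> T' -> R) :
  0 < h -> 0 < e0 -> (forall t, `|t - u| < e0 -> U t) ->
  (forall t v, U t -> U v -> measurable_fun [set: T] (X t v)) ->
  (forall w, paths F U (fun t => X t u w)) ->
  (forall w, paths F U (fun t => X t t w)) ->
  strongly_localisable F P U (fun t => X t u) u h P' Xu' ->
  (forall c : R, 0 < c ->
     P (large_increment X U u h c e) @[e --> (0 : R)^'+] --> 0%E) ->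
  strongly_localisable F P U (fun t => X t t) u h P' Xu'.
Proof.
move=> h0 e00 HU mX pXu pX [Y [Y' [vY vY' locT locC]]] H.
have Uu : U u by apply: HU; rewrite subrr normr0.
have mD : process U (fun t => X t t) by move=> t Ut; exact: mX.
have [mY _ pY] := vY; have [mY' _ pY'] := vY'.
have close := rescaled_close h0 e00 HU mX pXu pX vY H.
(* The diagonal has regular paths, so it is its own version; the version of the limit is kept. *)
exists (fun t => X t t), Y'; split=> //.
- by split=> // t Ut; exact: aeW.
- move=> UT; have inU t : U t by rewrite UT.
  have re (V : R -> T -> R) r : process U V -> (forall w, paths F U (V ^~ w)) ->
      0 < r -> random_element (paths F [set: R]) (line_dist F) (rescaled V u h r).
    move=> mV pV r0; apply: random_element_line => [t|w].
      exact: measurable_rescaled mV _ _.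
    by apply: paths_affine (pV w).
  apply: (slutsky (Z := rescaled Y u h) (delta := 1)) => //.
  + exact: pseudometric_line_dist.
  + by apply: random_element_line => // t; exact: mY'.
  + by move=> r /andP[r0 _]; split; exact: re.
  + move=> e p ep p0; have e4 : 0 < e / 4 by rewrite divr_gt0.
    (* Uniform closeness is only available on bounded sets; the terms of the line distance beyond
       [K] cost at most [2^-K]. *)
    have [K HK] := expr_half_lt e4.
    have K0 : (0 : R) < K.+1%:R by [].
    have [delta d0 Hd] := close K.+1%:R (e / 4) p K0 e4 p0.
    exists delta => // r /Hd[B [mB PB HB]]; exists B; split=> // w /HB {}HB.
    apply: (@le_lt_trans _ _ (e / 4 + 2^-1 ^+ K)%:E); last by rewrite lte_fin; lra.
    apply: line_dist_le => [|k /andP[_ kK]]; first exact: ltW.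
    have k0 : (0 : R) <= k%:R by [].
    apply: compact_dist_le => // [|t tk]; first by lra.
    apply: HB; apply: (@le_trans _ _ k%:R); first by rewrite ler_norml.
    by rewrite ler_nat leqW.
  + exact: locT.
(* [K] strictly dominates [|t|] on [[a, b]], so for [r < e0 / K] the rescaled paths only look at
   times in the ball around [u] contained in [U]. *)
- move=> UT a b ab; pose K := Num.max `|a| `|b| + 1.
  have K0 : 0 < K by rewrite ltr_wpDl// le_max normr_ge0.
  have tK t : a <= t <= b -> `|t| < K.
    move=> /andP[ta tb]; apply: le_lt_trans (_ : _ <= Num.max `|a| `|b|) _; last by rewrite ltrDl.
    rewrite ler_norml lerNl !le_max; apply/andP; split; apply/orP; [left|right].
      by rewrite -[`|a|]normrN (le_trans _ (ler_norm _))// lerN2.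
    by apply: le_trans tb (ler_norm b).
  have inU r t : 0 < r < e0 / K -> a <= t <= b -> U (u + r * t).
    move=> /andP[r0]; rewrite ltr_pdivlMr// => rK /tK tab.
    apply: HU; rewrite addrC addKr normrM gtr0_norm//.
    by apply: lt_trans rK; rewrite ltr_pM2l.
  have re (V : R -> T -> R) r : process U V -> (forall w, paths F U (V ^~ w)) ->
      0 < r < e0 / K ->
      random_element (paths F `[a, b]) (compact_dist F a b) (rescaled V u h r).
    move=> mV pV rK; apply: random_element_compact => // [t tab|w].
      by apply: measurable_rescaled mV _ _ => //; exact: inU.
    apply: paths_affine (pV w); first by case/andP: rK.
    by move=> t; rewrite /= in_itv/=; exact: inU.
  apply: (slutsky (Z := rescaled Y u h) (delta := e0 / K)).
  + by apply: pseudometric_compact_dist; exact: ltW.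
  + apply: random_element_compact => // [t _|w]; first exact: mY'.
    by apply: paths_sub (pY' w).
  + by rewrite divr_gt0.
  + by move=> r rK; split; exact: re.
  + move=> e p ep p0; have e2 : 0 < e / 2 by rewrite divr_gt0.
    have [delta d0 Hd] := close K (e / 2) p K0 e2 p0.
    exists delta => // r /Hd[B [mB PB HB]]; exists B; split=> // w /HB {}HB.
    apply: (@le_lt_trans _ _ (e / 2)%:E); last by rewrite lte_fin; lra.
    apply: compact_dist_le => // [|t tab]; first exact: ltW.
    by apply: HB; apply/ltW/tK.
  + exact: locC.
Qed.

Theorem theorem5p1 (R : realType) (F : path_class)
    (d : measure_display) (T : measurableType d) (P : probability T R)
    (d' : measure_display) (T' : measurableType d') (P' : probability T' R)
    (U : set R) (u h : R) (X : R -> R -> T -> R) (Xu' : R -> T' -> R)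
    (HU : is_interval U) (Hu : (U°) u) (Hh : 0 < h)
    (HX : forall t v, U t -> U v -> measurable_fun [set: T] (X t v))
    (HXu' : process [set: R] Xu')
    (HXu : forall w, paths F U (fun t => X t u w))
    (HXu'F : forall w, paths F [set: R] (fun t => Xu' t w))
    (Hloc : strongly_localisable F P U (fun t => X t u) u h P' Xu')
    (HY : forall w, paths F U (fun t => X t t w)) :
  ((forall c : R, 0 < c ->
      P [set w | (c%:E < increment_ratio_sup X u h
                           [set v | (U v /\ 0 < `|v - u| < e)%R] w)%E]
        @[e --> (0 : R)^'+] --> 0%E) ->
    strongly_localisable F P U (fun t => X t t) u h P' Xu') /\
  (forall eta : R, h < eta ->
    {ae P, forall w, (increment_ratio_sup X u eta
                        [set v | (U v /\ v != u)%R] w < +oo)%E} ->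
    strongly_localisable F P U (fun t => X t t) u h P' Xu').
Proof.
have /nbhs_ballP[e0 /= e00 He0] := Hu.
have HU' t : `|t - u| < e0 -> U t.
  by move=> tu; apply: He0; rewrite /ball/= distrC.
have main := strongly_localisable_diagonal Hh e00 HU' HX HXu HY Hloc.
split=> [H|eta eta_gt H]; apply: main => c c0; first exact: H.
exact: cvg_probability_large_increment eta_gt e00 HU' HX HXu HY H c c0.
Qed.
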